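(* Let $V=\mathbb{R}^n$ with its Euclidean inner product, and let $G\subset GL(n,\mathbb{R})$ be a non-compact closed linear group which admits a Cartan decomposition with respect to the involution $\Theta$, so that $G\cong K\times\exp(\mathfrak{p}_0)$, where $K=\{x\in G:\Theta x=x\}$ is a compact subgroup of $O(n)$. Suppose that $\dim \mathrm{Val}^K(V)<\infty$, and let $\psi_1,\dots,\psi_N$ be a basis of $\mathrm{Val}^K(V)$ consisting of homogeneous valuations. Let $\phi\in \mathrm{Val}^K(V)$, and let $c_{ij}^{\phi}$ ($1\le i,j\le N$) be the real constants, depending only on $\phi$ and on the chosen basis, for which $$\int_{\overline{K}}\phi(M\cap\overline{k}L)\,d\mu_{\overline{K}}(\overline{k})=\sum_{i=1}^N\sum_{j=1}^N c_{ij}^{\phi}\,\psi_i(M)\,\psi_j(L)\qquad\text{for all } M,L\in\mathcal{K}(V).$$ Then there are real constants $c_j(\psi_l)$, for $1\le j\le N$ and for those $l$ with $\deg(\psi_l)=\deg(\psi_j)$, such that for all $M,L\in\mathcal{K}(V)$ $$\int_{\overline{G}}\phi(M\cap\overline{g}L)\,dm_{\overline{G}}(\overline{g})=\sum_{i=1}^N\sum_{j=1}^N\ \sum_{\psi_l\in \mathrm{Val}^K_{\deg(\psi_j)}(V)} c_{ij}^{\phi}\,c_j(\psi_l)\,\psi_i(M)\,\psi_l(L),$$ where the innermost sum runs over the basis elements $\psi_l$ that are homogeneous of degree $\deg(\psi_j)$.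
   Context: **Valuations.** $\mathcal{K}(V)$ is the set of non-empty compact convex subsets (convex bodies) of $V$, with the Hausdorff metric. A valuation is a function $\Phi:\mathcal{K}(V)\to\mathbb{R}$ with $\Phi(M\cup L)=\Phi(M)+\Phi(L)-\Phi(M\cap L)$ whenever $M,L,M\cup L\in\mathcal{K}(V)$. The convention $\Phi(\emptyset)=0$ is used. $\mathrm{Val}(V)$ is the space of translation-invariant valuations that are continuous for the Hausdorff metric. $\mathrm{Val}_j(V)$ is the subspace of $\varphi$ with $\varphi(\lambda M)=\lambda^j\varphi(M)$ for all $\lambda\ge 0$ and $M\in\mathcal{K}(V)$ (homogeneous of degree $j$; one writes $\deg\varphi=j$). $\mathrm{Val}^K(V)$ and $\mathrm{Val}_j^K(V)$ are the subspaces of $K$-invariant elements, i.e. those with $\varphi(kM)=\varphi(M)$ for all $k\in K$. By McMullen's theorem, $\mathrm{Val}^K(V)=\bigoplus_{j=0}^n \mathrm{Val}^K_j(V)$, so a basis of homogeneous valuations exists when $\dim\mathrm{Val}^K(V)<\infty$. **Cartan decomposition.** Let $\mathfrak{g}_0$ be the Lie algebra of $G$ and $B(X,Y)=\mathrm{Tr}(\mathrm{ad}(X)\circ\mathrm{ad}(Y))$ its Killing form. A Cartan involution is a Lie algebra automorphism $\theta$ of $\mathfrak{g}_0$ with $\theta^2=\mathrm{id}$ such that $B_\theta(X,Y)=-B(X,\theta Y)$ is positive definite. Let $\mathfrak{k}_0$ and $\mathfrak{p}_0$ be the $+1$ and $-1$ eigenspaces of $\theta$, so $\mathfrak{g}_0=\mathfrak{k}_0\oplus\mathfrak{p}_0$.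 That $G$ admits a Cartan decomposition with respect to $\Theta$ means: $\Theta:G\to G$ is an involutive Lie group automorphism with differential $\theta$, $K=\{x\in G:\Theta x=x\}$, and $K\times\mathfrak{p}_0\to G$, $(k,X)\mapsto k\exp X$, is a diffeomorphism. **Measures.** $\nu_K$ is the Haar probability measure on $K$ and $\lambda_V$ is Lebesgue measure on $V$. Equip $\mathfrak{p}_0$ with the Frobenius inner product $\langle X,Y\rangle_F=\mathrm{tr}(X^TY)$ and norm $\|X\|_F$, and let $d=\dim\mathfrak{p}_0$. The Gaussian measure on $\mathfrak{p}_0$ is $$\gamma_{\mathfrak{p}_0}(A)=(2\pi)^{-d/2}\int_A e^{-\frac12\|X\|_F^2}\,d\rho(X)\qquad (A\subset\mathfrak{p}_0 \text{ Borel}),$$ where $\rho$ is the Lebesgue measure on $\mathfrak{p}_0$ obtained as the pushforward of Lebesgue measure on $\mathbb{R}^d$ by a linear map sending the canonical basis to an orthonormal basis of $\mathfrak{p}_0$. The groups $\overline{K}=K\ltimes V$ and $\overline{G}=G\ltimes V$ act on $V$ by affine maps: $\overline{g}x=gx+t$ with $g$ in the linear group and $t\in V$. The measure $\mu_{\overline{K}}$ is the Haar measure on $\overline{K}$ giving mass $1$ to $\{x\mapsto kx+t: k\in K,\ t\in[0,1]^n\}$, i.e. $\mu_{\overline{K}}=\nu_K\times\lambda_V$. The measure $m_{\overline{G}}=\nu_K\times\gamma_{\mathfrak{p}_0}\times\lambda_V$ is defined through $(k,X,t)\mapsto\overline{g}$, $\overline{g}x=ke^Xx+t$; thus $$\int_{\overline{G}}\phi(M\cap\overline{g}L)\,dm_{\overline{G}}(\overline{g})=\int_K\int_{\mathfrak{p}_0}\int_V\phi\big(M\cap(ke^XL+t)\big)\,d\lambda_V(t)\,d\gamma_{\mathfrak{p}_0}(X)\,d\nu_K(k).$$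 **Existence of the constants $c^\phi_{ij}$.** For compact $K$ with $\dim\mathrm{Val}^K(V)<\infty$, the constants $c_{ij}^\phi$ in the formula over $\overline{K}$ are known to exist (classical kinematic formula). *)

(* Defs.v *)
From HB Require Import structures.
From mathcomp Require Import all_boot all_order all_algebra.
From mathcomp Require Import all_classical all_reals all_analysis.

Set Implicit Arguments.
Unset Strict Implicit.
Unset Printing Implicit Defensive.

Import Order.TTheory GRing.Theory Num.Theory.
Import numFieldNormedType.Exports.

Local Open Scope classical_set_scope.
Local Open Scope ring_scope.

Section smooth.
Context {R : realType}.
Implicit Types E F : normedModType R.

(* Meant for open [U]; in finite dimension this is the usual class [C^k]. *)
Fixpoint is_Ck E F (k : nat) (U : set E) (f : E -> F) : Prop :=
  if k is k'.+1 then
    (forall x, U x -> differentiable f x) /\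
    (forall v, is_Ck k' U (fun x => 'D_v f x))
  else forall x, U x -> {for x, continuous f}.

(* Smoothness on a subset: locally the restriction of a smooth map of the
   ambient space.  For embedded submanifolds, such as closed linear groups,
   this is smoothness in the sense of manifolds. *)
Definition smooth_on E F (S : set E) (f : E -> F) : Prop :=
  forall x, S x -> exists (U : set E) (g : E -> F),
    [/\ open U, U x, (forall k, is_Ck k U g) &
        (forall y, U y -> S y -> g y = f y)].

Definition diffeomorphism E F (S : set E) (T : set F) (f : E -> F) : Prop :=
  [/\ smooth_on S f, (forall x, S x -> T (f x)) &
      exists g : F -> E,
        [/\ smooth_on T g, (forall y, T y -> S (g y)),
            (forall x, S x -> g (f x) = x) & (forall y, T y -> f (g y) = y)]].

End smooth.

Section linear_groups.
Context {R : realType} {n : nat}.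
Implicit Types (G : set 'M[R]_n) (g : {vspace 'M[R]_n}).

Definition expmx (X : 'M[R]_n) : 'M[R]_n :=
  limn (series (fun k => (k`!%:R)^-1 *: X ^+ k)).

(* [G] is closed in [GL_n], but not necessarily in the space of matrices. *)
Record closed_linear_group G : Prop := {
  clg_unit : forall x, G x -> x \in unitmx ;
  clg_1 : G 1%:M ;
  clg_mul : forall x y, G x -> G y -> G (x *m y) ;
  clg_inv : forall x, G x -> G (invmx x) ;
  clg_closed : forall x, x \in unitmx -> closure G x -> G x }.

Definition is_lie_algebra G g : Prop :=
  forall X, X \in g <-> forall t : R, G (expmx (t *: X)).

Definition lie_bracket (X Y : 'M[R]_n) : 'M[R]_n := X *m Y - Y *m X.

Definition trace_on (U : {vspace 'M[R]_n}) (f : 'M[R]_n -> 'M[R]_n) : R :=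
  \sum_(i < \dim U) coord (vbasis U) i (f (vbasis U)`_i).

Definition killing_form g (X Y : 'M[R]_n) : R :=
  trace_on g (fun Z => lie_bracket X (lie_bracket Y Z)).

(* A linear endomorphism of [g] is represented by a linear endomorphism of
   the matrix space, whose values outside [g] are irrelevant. *)
Record cartan_involution g (theta : 'End('M[R]_n)) : Prop := {
  ci_stable : forall X, X \in g -> theta X \in g ;
  ci_bracket : forall X Y, X \in g -> Y \in g ->
    theta (lie_bracket X Y) = lie_bracket (theta X) (theta Y) ;
  ci_invol : forall X, X \in g -> theta (theta X) = X ;
  ci_pos : forall X, X \in g -> X != 0 ->
    0 < - killing_form g X (theta X) }.

Record involutive_lie_automorphism G (Theta : 'M[R]_n -> 'M[R]_n) : Prop := {
  ila_stable : forall x, G x -> G (Theta x) ;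
  ila_mul : forall x y, G x -> G y -> Theta (x *m y) = Theta x *m Theta y ;
  ila_invol : forall x, G x -> Theta (Theta x) = x ;
  ila_smooth : smooth_on G Theta }.

Definition is_differential g (Theta : 'M[R]_n -> 'M[R]_n)
    (theta : 'End('M[R]_n)) : Prop :=
  forall X, X \in g ->
    is_derive (0 : R) 1 (fun t : R => Theta (expmx (t *: X))) (theta X).

Definition fixed_subgroup G (Theta : 'M[R]_n -> 'M[R]_n) : set 'M[R]_n :=
  [set x | G x /\ Theta x = x].

Definition noncompact_part g (theta : 'End('M[R]_n)) : {vspace 'M[R]_n} :=
  (g :&: passmx.leigenspace theta (- 1))%VS.

Record cartan_decomposition G g (Theta : 'M[R]_n -> 'M[R]_n)
    (theta : 'End('M[R]_n)) : Prop := {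
  cd_auto : involutive_lie_automorphism G Theta ;
  cd_diff : is_differential g Theta theta ;
  cd_cartan : cartan_involution g theta ;
  cd_diffeo : diffeomorphism
    (fixed_subgroup G Theta `*` [set X | X \in noncompact_part g theta]) G
    (fun kX : 'M[R]_n * 'M[R]_n => kX.1 *m expmx kX.2) }.

Definition frob_inner (X Y : 'M[R]_n) : R := \tr (X^T *m Y).

Definition orthonormal_basis_of (U : {vspace 'M[R]_n}) d
    (e : d.-tuple 'M[R]_n) : Prop :=
  basis_of U e /\
  forall i j : 'I_d, frob_inner (tnth e i) (tnth e j) = (i == j)%:R.

End linear_groups.

Notation borel T := (g_sigma_algebraType (@open T)).

Section measures.
Context {R : realType}.

(* Lebesgue measure on R^(m+1) is the product of those on R and R^m. *)
Fixpoint lebesgue_cV (m : nat) : set (borel 'cV[R]_m) -> \bar R :=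
  if m is m'.+1 then
    pushforward (@lebesgue_measure R \x @lebesgue_cV m')%E
      (fun xv : measurableTypeR R * borel 'cV[R]_m' =>
         col_mx (xv.1%:M : 'M[R]_1) (xv.2 : 'cV[R]_m') : borel 'cV[R]_m'.+1)
  else \d_((0 : 'cV[R]_0) : borel 'cV[R]_0).

Definition haar_probability n (K : set 'M[R]_n)
    (nu : probability (borel 'M[R]_n) R) : Prop :=
  nu K = 1%E /\
  forall (k : 'M[R]_n) (A : set (borel 'M[R]_n)), K k -> measurable A ->
    nu [set k *m x | x in A] = nu A.

(* Lebesgue and Gaussian measures on the span of the orthonormal family [e],
   as measures on the whole matrix space. *)
Definition lebesgue_span n d (e : d.-tuple 'M[R]_n) :
    set (borel 'M[R]_n) -> \bar R :=
  pushforward (@lebesgue_cV d)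
    (fun x : borel 'cV[R]_d =>
       \sum_(i < d) (x : 'cV[R]_d) i 0 *: tnth e i : borel 'M[R]_n).

Definition gaussian_span n d (e : d.-tuple 'M[R]_n)
    (A : set (borel 'M[R]_n)) : \bar R :=
  (((2 * pi) `^ (- (d%:R / 2)))%:E *
   \int[lebesgue_span e]_(X in A) (expR (- (2^-1 * frob_inner X X)))%:E)%E.

End measures.

Section valuations.
Context {R : realType} {n : nat}.
Local Notation V := 'cV[R]_n.

Definition is_convex_body (A : set V) : Prop :=
  [/\ A !=set0, compact A & convex_set A].

Record convex_body := ConvexBody {
  body_set :> set V ;
  body_convex : is_convex_body body_set }.

Implicit Types (phi : convex_body -> R) (M L : convex_body).

(* Extension by 0 to the sets that are not convex bodies; in particular this
   is the convention that valuations vanish on the empty set. *)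
Definition extend0 phi (A : set V) : R :=
  if pselect (is_convex_body A) is left hA then phi (ConvexBody hA) else 0.

(* The library norm on matrices is the maximum norm. *)
Definition euclidean_norm (x : V) : R := Num.sqrt (\sum_(i < n) x i 0 ^+ 2).

Definition hausdorff_dist (A B : set V) : R :=
  inf [set r : R | [/\ 0 <= r,
    (forall x, A x -> exists2 y, B y & euclidean_norm (x - y) <= r) &
    (forall y, B y -> exists2 x, A x & euclidean_norm (x - y) <= r)]].

Definition valuation phi : Prop :=
  forall M L, is_convex_body (M `|` L) ->
    extend0 phi (M `|` L) = phi M + phi L - extend0 phi (M `&` L).

Definition translation_invariant phi : Prop :=
  forall M (t : V), extend0 phi [set x + t | x in M] = phi M.

Definition hausdorff_continuous phi : Prop :=
  forall M (eps : R), 0 < eps -> exists2 delta : R, 0 < delta &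
    forall L, hausdorff_dist M L < delta -> `|phi L - phi M| < eps.

Definition Val : set (convex_body -> R) :=
  [set phi | [/\ valuation phi, translation_invariant phi &
                 hausdorff_continuous phi]].

Definition homogeneous_of_degree (j : nat) phi : Prop :=
  forall (lam : R) M, 0 <= lam ->
    extend0 phi [set lam *: x | x in M] = lam ^+ j * phi M.

Definition invariant_under (K : set 'M[R]_n) phi : Prop :=
  forall (k : 'M[R]_n) M, K k -> extend0 phi [set k *m x | x in M] = phi M.

Definition ValK (K : set 'M[R]_n) : set (convex_body -> R) :=
  [set phi | Val phi /\ invariant_under K phi].

Definition ValKj (K : set 'M[R]_n) (j : nat) : set (convex_body -> R) :=
  [set phi | ValK K phi /\ homogeneous_of_degree j phi].

Definition is_basis (S : set (convex_body -> R)) N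
    (psi : 'I_N -> convex_body -> R) : Prop :=
  [/\ (forall i, S (psi i)),
      (forall a : 'I_N -> R,
         (forall M, \sum_(i < N) a i * psi i M = 0) -> forall i, a i = 0) &
      (forall phi, S phi -> exists a : 'I_N -> R,
         forall M, phi M = \sum_(i < N) a i * psi i M)].

End valuations.

Arguments convex_body : clear implicits.

Section kinematic.
Context {R : realType} {n : nat}.
Implicit Types (phi : convex_body R n -> R) (M L : convex_body R n).
Implicit Types (K : set 'M[R]_n) (nu : probability (borel 'M[R]_n) R).

Definition affine_image (g : 'M[R]_n) (t : 'cV[R]_n) (L : set 'cV[R]_n) :
  set 'cV[R]_n := [set g *m x + t | x in L].

Definition kinematic_K K nu phi M L : \bar R :=
  (\int[nu \x @lebesgue_cV R n]_(z in K `*` setT)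
     (extend0 phi (M `&` affine_image z.1 z.2 L))%:E)%E.

Definition kinematic_G K nu d (p0 : {vspace 'M[R]_n})
    (e : d.-tuple 'M[R]_n) phi M L : \bar R :=
  (\int[(nu \x gaussian_span e) \x @lebesgue_cV R n]_(z in
       (K `*` [set X | X \in p0]) `*` setT)
     (extend0 phi (M `&` affine_image (z.1.1 *m expmx z.1.2) z.2 L))%:E)%E.

End kinematic.

(* Main.v *)
(* By Fubini's theorem, the integral over
   [G] is the integral over [X] in [p0] of the integral over [K] for the bodies
   [M] and [e^X L].  Inserting the formula over [K] leaves the functions
   [L |-> \int psi_j (e^X L)], which are again continuous translation-invariant
   valuations, homogeneous of the degree of [psi_j].  They are [K]-invariant,
   since [e^X k = k e^(k^-1 X k)] and the Gaussian measure on [p0] is invariant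
   under conjugation by [K].  Hence they are combinations of the [psi_l] of that
   degree.  Integrability comes from [|e^X| <= e^(c |X|)], the exponential moments
   of the Gaussian measure, and the boundedness of continuous valuations on the
   bodies inside a fixed compact set. *)
Require Import Defs.
From HB Require Import structures.
From mathcomp Require Import all_boot all_order all_algebra.
From mathcomp Require Import all_classical all_reals all_analysis.
From mathcomp Require Import measurable_realfun lra.

Set Implicit Arguments.
Unset Strict Implicit.
Unset Printing Implicit Defensive.

Import Order.TTheory GRing.Theory Num.Theory.
Import numFieldNormedType.Exports.

Local Open Scope classical_set_scope.
Local Open Scope ring_scope.

(** * Borel sets and Lebesgue measure on column vectors *)

(** The main obstacle is measurability. Even among the positions where [M] meets [g L + t], the
    intersection does not depend continuously on [(g, t)]: two squares sharing an edge may share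
    only a vertex after a small rotation. Thickening [M] removes the touching positions, and the
    original function is a pointwise limit of the thickened ones. Lebesgue measure on column vectors
    is an iterated product tied to the coordinates. Its invariance under orthogonal matrices, on
    which the conjugation invariance of the Gaussian measure rests, is derived from a uniqueness
    argument for translation-invariant measures. Homogeneity turns a bound for [psi j] on the bodies
    inside one ball into growth of order [|e^X|^(deg j)]. For [phi], the growth comes instead from
    the volume of the set of translations for which the bodies meet, which is of order [|e^X|^n].
    The constants of the theorem are the coordinates of the averaged [psi j] in the basis. *)

Lemma countable_bigcup_measurable d (T : measurableType d) (I : Type) (D : set I)
    (F : I -> set T) :
  countable D -> (forall i, D i -> measurable (F i)) ->
  measurable (\bigcup_(i in D) F i).
Proof.
move=> /countable_injP[f injf] mF.
have -> : \bigcup_(i in D) F i = \bigcup_n \bigcup_(i in [set i | D i /\ f i = n]) F i.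
  apply/seteqP; split=> [x [i Di Fx]|x [n _ [i [Di _] Fx]]]; last by exists i.
  by exists (f i) => //; exists i.
apply: bigcupT_measurable => n.
have [[i [Di fi]]|H] := pselect (exists i, D i /\ f i = n).
  rewrite [X in measurable X](_ : _ = F i); first exact: mF.
  apply/seteqP; split=> [x [j [Dj fj] Fx]|x Fx]; last by exists i.
  by rewrite (injf i j) ?inE// fi fj.
rewrite [X in measurable X](_ : _ = set0)//.
by apply/seteqP; split=> // x [j ? _]; apply: H; exists j.
Qed.

(** An open set of the product is the union of the basic rectangles inside it, and second
    countability makes this union countable. This links topology to measure: the kinematic integrals
    live on product sigma-algebras, while the sets to be measured are known to be open or closed. *)
Lemma open_prod_second_countable (T1 T2 : ptopologicalType)
    (G1 : set (set T1)) (G2 : set (set T2)) :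
  @second_countable T1 -> @second_countable T2 ->
  @open T1 `<=` <<s G1 >> -> @open T2 `<=` <<s G2 >> ->
  forall O : set (T1 * T2), open O ->
  measurable (O : set (g_sigma_algebraType G1 * g_sigma_algebraType G2)%type).
Proof.
move=> [B1 cB1 [oB1 bB1]] [B2 cB2 [oB2 bB2]] h1 h2 O oO.
pose I := [set b : set T1 * set T2 | [/\ B1 b.1, B2 b.2 & b.1 `*` b.2 `<=` O]].
have -> : O = \bigcup_(b in I) (b.1 `*` b.2).
  apply/seteqP; split => [[x y] Oxy|z [b [_ _ +] bz]]; last exact.
  have [[U V] /= [Ux Vy] UV] : nbhs (x, y) O by exact: open_nbhs_nbhs.
  have [b1 [B1b b1x] b1U] := bB1 x _ Ux.
  have [b2 [B2b b2y] b2V] := bB2 y _ Vy.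
  exists (b1, b2) => //; split => // -[a b] /= [? ?]; apply: UV.
  by split; [exact: b1U|exact: b2V].
apply: countable_bigcup_measurable => [|[b1 b2] [/= ? ? _]].
  apply: (@sub_countable _ _ _ (B1 `*` B2)).
    by apply: subset_card_le => b [].
  exact: countableX.
apply: measurableX.
  by apply: h1; exact: oB1.
by apply: h2; exact: oB2.
Qed.

Lemma dense_second_countable (R : realType) (T : normedModType R) (D : set T) :
  countable D -> dense D -> @second_countable T.
Proof.
move=> cD dD.
pose B := (fun p : T * nat => ball p.1 (p.2.+1%:R^-1 : R)) @` (D `*` setT).
exists B.
  apply: (card_le_trans (card_image_le _ _)).
  exact: countableX.
split=> [_ [p _ <-]|x U]; first exact: ball_open.
rewrite -nbhs_ballE => -[e /= e0 xeU].
have [|k] := @ltr_add_invr R 0 (e / 2) _; first by rewrite divr_gt0.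
rewrite add0r => ke.
have [d [xd Dd]] : ball x (k.+1%:R^-1 : R) `&` D !=set0.
  apply: dD; last exact: ball_open.
  by exists x; apply: ballxx; rewrite invr_gt0.
exists (ball d (k.+1%:R^-1 : R)); first split.
- by exists (d, k).
- exact: ball_sym.
- move=> y dy; apply: xeU; rewrite [e]splitr.
  by apply: (ball_triangle (le_ball (ltW ke) xd)); exact: (le_ball (ltW ke)).
Qed.

Lemma mx_second_countable (R : realType) (m n : nat) :
  @second_countable 'M[R]_(m, n).
Proof.
apply: (@dense_second_countable _ _ (range (fun q : 'M[rat]_(m, n) => map_mx (@ratr R) q))).
  apply: (card_le_trans (card_image_le _ _)).
  exact: countableP.
move=> U [x Ux] oU.
have : nbhs x U by exact: open_nbhs_nbhs.
rewrite -nbhs_ballE => -[e /= e0 xeU].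
have H i j : exists q : rat, ball (x i j) e (ratr q).
  have [z [qx [q _ qz]]] : ball (x i j) e `&` range (@ratr R) !=set0.
    by apply: dense_rat; [exists (x i j); exact: ballxx|exact: (@ball_open _ R^o)].
  by exists q; rewrite qz.
exists (map_mx ratr (\matrix_(i, j) xchoose (H i j))); split; last first.
  by eexists.
apply: xeU; split=> // i j; rewrite !mxE; exact: (xchooseP (H i j)).
Qed.

Lemma R_second_countable (R : realType) : @second_countable R.
Proof.
apply: (@dense_second_countable _ R^o (range ratr)); last exact: dense_rat.
apply: (card_le_trans (card_image_le _ _)).
exact: countableP.
Qed.

Lemma measurable_open_mx2 (R : realType) (m n p q : nat) (O : set ('M[R]_(m, n) * 'M[R]_(p, q))) :
  open O -> measurable (O : set (borel 'M[R]_(m, n) * borel 'M[R]_(p, q))%type).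
Proof.
apply: open_prod_second_countable; try exact: mx_second_countable.
all: exact: sub_sigma_algebra.
Qed.

Lemma measurable_open_Rmx (R : realType) (m n : nat) (O : set (R * 'M[R]_(m, n))) :
  open O -> measurable (O : set (measurableTypeR R * borel 'M[R]_(m, n))%type).
Proof.
apply: open_prod_second_countable.
- exact: R_second_countable.
- exact: mx_second_countable.
- by move=> O0; exact: open_measurable.
- exact: sub_sigma_algebra.
Qed.

Lemma borel_measurable_fun d (T : measurableType d) (U : ptopologicalType) (D : set T) (f : T -> U) :
  measurable D -> (forall O, open O -> measurable (D `&` f @^-1` O)) ->
  measurable_fun D (f : T -> borel U).
Proof.
move=> mD h; apply: (measurability (rT := borel U) (@open U)) => //.
by move=> _ [B oB <-]; exact: h.
Qed.

Lemma measurable_open_borel (U : ptopologicalType) (O : set U) :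
  open O -> measurable (O : set (borel U)).
Proof. exact: sub_sigma_algebra. Qed.

Lemma measurable_closed_borel (U : ptopologicalType) (O : set U) :
  closed O -> measurable (O : set (borel U)).
Proof.
by move=> cO; rewrite -(setCK O); apply: measurableC; apply: measurable_open_borel; exact: closed_openC.
Qed.

Lemma cvg_mx (R : realType) (T : Type) (F : set_system T) (FF : Filter F) m n
    (f : T -> 'M[R]_(m, n)) (l : 'M[R]_(m, n)) :
  (forall i j, (f x i j) @[x --> F] --> l i j) -> f x @[x --> F] --> l.
Proof.
move=> h; apply/cvg_ballP => e e0.
have : \forall x \near F, forall ij : 'I_m * 'I_n, ball (l ij.1 ij.2) e (f x ij.1 ij.2).
  apply: filter_forall => -[i j] /=.
  by have /cvg_ballP/(_ e e0) := h i j.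
by apply: filterS => x H; split=> // i j; have := H (i, j).
Qed.

Lemma continuous_mx (R : realType) (T : topologicalType) m n (f : T -> 'M[R]_(m, n)) :
  (forall i j, continuous (fun x => f x i j)) -> continuous f.
Proof. by move=> h x; apply: cvg_mx => i j; exact: h. Qed.

Lemma ler_mx_norm (R : realType) m n (x : 'M[R]_(m, n)) i j : `|x i j| <= `|x|.
Proof.
rewrite [leRHS]/Num.Def.normr /= mx_normrE; apply: (le_bigmax _ (fun ij : 'I_m * 'I_n => `|x ij.1 ij.2|) (i, j)).
Qed.

Lemma mx_norm_le (R : realType) m n (x : 'M[R]_(m, n)) r : 0 <= r ->
  (forall i j, `|x i j| <= r) -> `|x| <= r.
Proof.
move=> r0 h; rewrite [leLHS]/Num.Def.normr /= mx_normrE; apply/bigmax_leP; split=> // -[i j] _; exact: h.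
Qed.

Lemma measurable_col_mx (R : realType) m :
  measurable_fun setT (fun xv : measurableTypeR R * borel 'cV[R]_m =>
         col_mx (xv.1%:M : 'M[R]_1) (xv.2 : 'cV[R]_m) : borel 'cV[R]_m.+1).
Proof.
apply: borel_measurable_fun => // O oO; rewrite setTI.
apply: measurable_open_Rmx.
pose f (xv : R * 'cV[R]_m) := col_mx (xv.1%:M : 'M[R]_1) (xv.2 : 'cV[R]_m).
suff /continuousP : continuous f by apply.
apply: continuous_mx => i j x; rewrite /f.
under eq_fun do rewrite mxE.
case: (fintype.split i) => k.
  under eq_fun do rewrite mxE !ord1 eqxx mulr1n.
  by rewrite mxE !ord1 eqxx mulr1n; exact: cvg_fst.
by apply: (cvg_comp snd (fun v : 'cV[R]_m => v k j)); [exact: cvg_snd|exact: coord_continuous].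
Qed.

(** The measures of the statement are bare set functions. Lemmas of this form exhibit a bundled
    measure that equals such a function, and rewriting with the equation gives access to integration
    theory. *)
Lemma pushforward_measureP d d' (T1 : measurableType d) (T2 : measurableType d')
    (R : realType) (m : {measure set T1 -> \bar R}) (f : T1 -> T2) :
  measurable_fun setT f ->
  exists mu : {measure set T2 -> \bar R}, mu = pushforward m f :> (set T2 -> \bar R).
Proof.
by move=> mf; exists (measure_function_pushforward__canonical__measure_function_Measure m mf).
Qed.

Section sigma_finite_measure_of.
Context d (T : measurableType d) (R : realType) (mu : {measure set T -> \bar R}).
Hypothesis mu_sigma_finite : sigma_finite setT mu.

(* A named copy of [mu], to which the sigma-finite structure can be attached. *)
Definition sigma_finite_measure_of (A : set T) : \bar R := mu A.
Let m : set T -> \bar R := sigma_finite_measure_of.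

Let m0 : m set0 = 0%E. Proof. exact: measure0. Qed.
Let m_ge0 A : (0 <= m A)%E. Proof. exact: measure_ge0. Qed.
Let m_sigma_additive : semi_sigma_additive m.
Proof. exact: measure_semi_sigma_additive. Qed.

HB.instance Definition _ := isMeasure.Build _ _ _ m m0 m_ge0 m_sigma_additive.
HB.instance Definition _ := Measure_isSigmaFinite.Build _ _ _ m mu_sigma_finite.

Lemma sigma_finite_measureP :
  exists mu' : {sigma_finite_measure set T -> \bar R}, mu' = mu :> (set T -> \bar R).
Proof. by exists m. Qed.

End sigma_finite_measure_of.

Lemma ball_cV0 (R : realType) m (r : R) (x : 'cV[R]_m) : 0 < r ->
  ball (0 : 'cV[R]_m) r x <-> forall i, `|x i 0| < r.
Proof.
move=> r0; split=> [[_ h] i|h]; first by have := h i 0; rewrite /ball/= mxE sub0r normrN.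
by split=> // i j; rewrite ord1 /ball/= mxE sub0r normrN.
Qed.

(** For the maximum norm a ball is a cube, and [col_mx] splits it into an interval and a cube of one
    dimension less. The volumes of the cubes also drive the induction: they show that the next
    measure is sigma-finite, as the next product requires. *)
Lemma lebesgue_cV_measure (R : realType) m :
  exists2 mu : {sigma_finite_measure set (borel 'cV[R]_m) -> \bar R},
    mu = @lebesgue_cV R m :> (set _ -> \bar R) &
    forall r : R, 0 < r -> mu (ball (0 : 'cV[R]_m) r) = ((r *+ 2) ^+ m)%:E.
Proof.
elim: m => [|m [mu muE IH]].
  exists (dirac ((0 : 'cV[R]_0) : borel 'cV[R]_0)) => // r r0.
  transitivity ((\1_(ball (0 : 'cV[R]_0) r) (0 : 'cV[R]_0))%:E : \bar R) => //.
  by rewrite indicE mem_set//; exact: ballxx.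
have [mu0 mu0E] := pushforward_measureP (@lebesgue_measure R \x mu)%E (@measurable_col_mx R m).
have ballE (r : R) : 0 < r -> mu0 (ball (0 : 'cV[R]_m.+1) r) = ((r *+ 2) ^+ m.+1)%:E.
  move=> r0; rewrite mu0E /pushforward.
  rewrite [X in (_ \x _)%E X = _](_ : _ = ball (0 : R) r `*` ball (0 : 'cV[R]_m) r); last first.
    apply/seteqP; split=> -[x v] /=.
      move=> /(ball_cV0 _ r0) h0; split.
        have h : forall i : 'I_(1 + m), `|col_mx (x%:M : 'M[R]_1) (v : 'cV[R]_m) i 0| < r := h0.
        by have := h (lshift m 0 : 'I_(1 + m)); rewrite col_mxEu mxE eqxx mulr1n /ball/= sub0r normrN.
      have h : forall i : 'I_(1 + m), `|col_mx (x%:M : 'M[R]_1) (v : 'cV[R]_m) i 0| < r := h0.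
      by apply/(ball_cV0 _ r0) => i; have := h (rshift 1 i : 'I_(1 + m)); rewrite col_mxEd.
    move=> [hx /(ball_cV0 _ r0) hv]; apply/(ball_cV0 _ r0).
    suff : forall i : 'I_(1 + m), `|col_mx (x%:M : 'M[R]_1) (v : 'cV[R]_m) i 0| < r by [].
    move=> i; rewrite -(splitK (i : 'I_(1 + m))); case: (fintype.split (i : 'I_(1 + m))) => k /=.
      by rewrite col_mxEu mxE !ord1 eqxx mulr1n; move: hx; rewrite /ball/= sub0r normrN.
    by rewrite col_mxEd.
  rewrite product_measure1E//=; last first.
    by apply: measurable_open_borel; exact: ball_open.
    exact: measurable_ball.
  by rewrite IH// lebesgue_measure_ball ?ltW// exprS EFinM.
have [|mu' mu'E] := @sigma_finite_measureP _ _ _ mu0.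
  exists (fun n => ball (0 : 'cV[R]_m.+1) n.+1%:R).
    apply/seteqP; split=> // x _.
    have [k xk] : exists k : nat, `|x| < k.+1%:R.
      exists (Num.bound `|x|); apply: (lt_le_trans (archi_boundP _)) => //.
      by rewrite ler_nat.
    exists k => //; rewrite ball_cV0// => i.
    exact: (le_lt_trans (ler_mx_norm _ _ _)).
  move=> i; split; first by apply: measurable_open_borel; exact: ball_open.
  by rewrite ballE// ltry.
exists mu' => [|r r0]; last by rewrite mu'E ballE.
rewrite mu'E mu0E /=; congr pushforward; congr product_measure1; exact: muE.
Qed.

Lemma continuous_borel_measurable (U V : ptopologicalType) (f : U -> V) :
  continuous f -> measurable_fun setT (f : borel U -> borel V).
Proof.
move=> /continuousP cf; apply: borel_measurable_fun => // A oA; rewrite setTI.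
by apply: measurable_open_borel; exact: cf.
Qed.

(** * Translation and orthogonal invariance of Lebesgue measure *)

Lemma lebesgue_measure_shift (R : realType) (a : R) (A : set (measurableTypeR R)) :
  measurable A -> lebesgue_measure ((fun x : R => x + a) @^-1` A) = lebesgue_measure A.
Proof.
move=> mA.
have mf : measurable_fun setT (fun x : R => x + a : measurableTypeR R).
  exact: measurable_funD.
have [mu muE] := pushforward_measureP (@lebesgue_measure R) mf.
suff -> : lebesgue_measure A = mu A by rewrite muE.
apply: lebesgue_measure_unique => // X [[b c]] _ <-.
rewrite muE /pushforward.
rewrite [X in _ = _ X](_ : _ = `]b - a, c - a]%classic); last first.
  by apply/seteqP; split=> x /=; rewrite !in_itv/= ltrBlDr lerBrDr.
have E1 := lebesgue_measure_itv (`]b, c] : interval R).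
have E2 := lebesgue_measure_itv (`]b - a, c - a] : interval R).
apply: (eq_trans E1); apply: (eq_trans _ (esym E2)) => /=; rewrite !lte_fin ltrD2r.
by case: ifP => // _; rewrite -!EFinB; congr EFin; lra.
Qed.

Definition translation_invariant_measure (R : realType) (V : normedModType R)
    (mu : set V -> \bar R) :=
  forall (t : V) (A : set V), measurable (A : set (borel V)) ->
    mu ((fun x => x + t) @^-1` A) = mu A.

Lemma lebesgue_cV_translation (R : realType) m :
  translation_invariant_measure (@lebesgue_cV R m).
Proof.
elim: m => [|m IH] t A mA.
  congr (lebesgue_cV _); apply/seteqP; split => x /=; by rewrite (_ : x + t = x)//; apply/colP => -[].
have [mu muE _] := lebesgue_cV_measure R m.
rewrite /= -muE /pushforward /product_measure1.
pose B := (fun xv : measurableTypeR R * borel 'cV[R]_m =>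
         col_mx (xv.1%:M : 'M[R]_1) (xv.2 : 'cV[R]_m) : borel 'cV[R]_m.+1) @^-1` A.
have mB : measurable B by rewrite -[B]setTI; exact: measurable_col_mx.
pose t0 := t (lshift m 0 : 'I_(1 + m)) 0.
pose sh (x : R) : measurableTypeR R := x + t0.
(* The product measure integrates the measures of sections. The section at [x] of the shifted set is
   a translate of the section of [B] at [x + t0]; the induction hypothesis removes that translation,
   and the shift by [t0] is a change of variable in the outer integral. *)
transitivity (\int[@lebesgue_measure R]_x ((mu \o xsection B) \o sh) x)%E.
  apply: eq_integral => x _ /=.
  rewrite [in RHS]muE -(IH (dsubmx (t : 'cV[R]_(1 + m)))); last exact: measurable_xsection.
  rewrite -muE.
  have tE : (x%:M : 'M[R]_1) + usubmx (t : 'cV[R]_(1 + m)) = (x + t0)%:M.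
    by apply/matrixP => i j; rewrite !ord1 !mxE eqxx !mulr1n.
  have vE (v : 'cV[R]_m) : col_mx (x%:M : 'M[R]_1) v + (t : 'cV[R]_(1 + m)) =
      col_mx ((x + t0)%:M : 'M[R]_1) (v + dsubmx (t : 'cV[R]_(1 + m))).
    by rewrite -tE -[in LHS](vsubmxK (t : 'cV[R]_(1 + m))) add_col_mx.
  rewrite !xsectionE; congr (mu _).
  apply/seteqP; split => v; rewrite /preimage /= /B /preimage/= /sh -vE//.
have mf : measurable_fun [set: measurableTypeR R] (sh : measurableTypeR R -> measurableTypeR R) by exact: measurable_funD.
have mg : measurable_fun setT (mu \o xsection B) by exact: measurable_fun_xsection.
rewrite -[in LHS](@preimage_setT _ _ sh).
rewrite -(ge0_integral_pushforward mf)//.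
by apply: eq_measure_integral => C mC _; exact: lebesgue_measure_shift.
Qed.

(* As in the uniqueness of Haar measure: [1_A(x) 1_B(x + y)] is integrated over
   [x] and [y] in two ways. *)
Lemma translation_invariant_reflection (R : realType) m
    (la mu : {sigma_finite_measure set (borel 'cV[R]_m) -> \bar R})
    (A B : set (borel 'cV[R]_m)) :
  translation_invariant_measure la -> translation_invariant_measure mu ->
  measurable A -> measurable B ->
  (la A * mu B = mu (-%R @^-1` A) * la B)%E.
Proof.
move=> tla tmu mA mB.
have cD : continuous (fun z : 'cV[R]_m * 'cV[R]_m => z.1 + z.2).
  by move=> z; apply: cvgD; [exact: cvg_fst|exact: cvg_snd].
have cB : continuous (fun z : 'cV[R]_m * 'cV[R]_m => z.1 - z.2).
  by move=> z; apply: cvgB; [exact: cvg_fst|exact: cvg_snd].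
have mD : measurable_fun setT (fun z : borel 'cV[R]_m * borel 'cV[R]_m => (z.1 : 'cV[R]_m) + z.2 : borel 'cV[R]_m).
  apply: borel_measurable_fun => // U oU; rewrite setTI; apply: measurable_open_mx2.
  by move/continuousP : cD; apply.
have mS : measurable_fun setT (fun z : borel 'cV[R]_m * borel 'cV[R]_m => (z.1 : 'cV[R]_m) - z.2 : borel 'cV[R]_m).
  apply: borel_measurable_fun => // U oU; rewrite setTI; apply: measurable_open_mx2.
  by move/continuousP : cB; apply.
pose E := [set z : borel 'cV[R]_m * borel 'cV[R]_m | A z.1 /\ B ((z.1 : 'cV[R]_m) + z.2)].
pose E' := [set z : borel 'cV[R]_m * borel 'cV[R]_m | A ((z.1 : 'cV[R]_m) - z.2) /\ B z.1].
have mE : measurable E.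
  rewrite (_ : E = (fst @^-1` A) `&` ((fun z : borel 'cV[R]_m * borel 'cV[R]_m => (z.1 : 'cV[R]_m) + z.2 : borel 'cV[R]_m) @^-1` B))//.
  apply: measurableI; rewrite -[X in measurable X]setTI; first exact: measurable_fst.
  exact: mD.
have mE' : measurable E'.
  rewrite (_ : E' = ((fun z : borel 'cV[R]_m * borel 'cV[R]_m => (z.1 : 'cV[R]_m) - z.2 : borel 'cV[R]_m) @^-1` A) `&` (fst @^-1` B))//.
  apply: measurableI; rewrite -[X in measurable X]setTI; last exact: measurable_fst.
  exact: mS.
have swap (X : set (borel 'cV[R]_m * borel 'cV[R]_m)) : measurable X ->
    (\int[la]_x mu (xsection X x) = \int[mu]_y la (ysection X y))%E.
  move=> mX; have := indic_fubini_tonelli la mu mX.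
  by rewrite indic_fubini_tonelli_FE// indic_fubini_tonelli_GE.
transitivity (\int[la]_x mu (xsection E x))%E.
  rewrite -[in LHS](setIT A) -integral_indic// muleC -ge0_integralZl//; last first.
    by apply/measurable_EFinP; exact: measurable_indic.
  apply: eq_integral => x _; rewrite indicE; case: (boolP (x \in A)) => [/set_mem Ax|/negP nAx].
    rewrite mule1 -(tmu x)//; congr (mu _); apply/seteqP; split => y.
      by rewrite /xsection/= inE /E/= addrC.
    by rewrite /xsection/= inE /E/= addrC => -[].
  rewrite mule0 [X in mu X](_ : _ = set0) ?measure0//.
  by apply/seteqP; split => // y; rewrite /xsection/= inE /E/= => -[/mem_set].
rewrite swap//.
transitivity (\int[mu]_y la (ysection E' y))%E.
  (* For fixed [y], the substitution of [x - y] for [x], allowed by the invariance of [la], turns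
     the section of [E] into that of [E']. *)
  apply: eq_integral => y _; rewrite -(tla y (ysection E' y)); last exact: measurable_ysection.
  congr (la _); apply/seteqP; split => x; rewrite /ysection/= !inE /E/E'/= ?addrK//.
rewrite -swap//.
rewrite -[in RHS](setIT B) -integral_indic// -ge0_integralZl//; last first.
    by apply/measurable_EFinP; exact: measurable_indic.
apply: eq_integral => x _; rewrite indicE; case: (boolP (x \in B)) => [/set_mem Bx|/negP nBx].
  (* For [x] in [B] the section is the set of [y] with [x - y] in [A], a translate by [x] of the
     reflection of [A]. *)
  rewrite mule1 -(tmu (- x : 'cV[R]_m) (-%R @^-1` A)); last first.
    have cN : continuous (fun z : 'cV[R]_m => - z) by move=> z; exact: (cvgN (@cvg_id _ _)).
    by rewrite -[X in measurable X]setTI; exact: (continuous_borel_measurable cN).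
  congr (mu _); apply/seteqP; split => y; rewrite /xsection/= inE /E'/= opprB; tauto.
rewrite mule0 [X in mu X](_ : _ = set0) ?measure0//.
by apply/seteqP; split => // y; rewrite /xsection/= inE /E'/= => -[_ /mem_set].
Qed.

Lemma continuous_sumr (R : realType) (T : topologicalType) n (f : 'I_n -> T -> R) :
  (forall i, continuous (f i)) -> continuous (fun x => \sum_i f i x).
Proof.
move=> cf x; apply: cvg_big => [|k _]; last exact: cf.
by move=> z; exact: add_continuous.
Qed.

Lemma continuous_mulr (R : realType) (T : topologicalType) (f g : T -> R) :
  continuous f -> continuous g -> continuous (fun x => f x * g x).
Proof. by move=> cf cg x; apply: cvgM; [exact: cf|exact: cg]. Qed.

Lemma mulmx_continuous (R : realType) m n p (Q : 'M[R]_(m, n)) :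
  continuous (fun x : 'M[R]_(n, p) => Q *m x).
Proof.
apply: continuous_mx => i j; under eq_fun do rewrite mxE.
apply: continuous_sumr => k; apply: continuous_mulr; first exact: cst_continuous.
exact: coord_continuous.
Qed.

(** The library ball is a cube, which orthogonal matrices do not preserve; this ball serves as the
    test set of positive finite measure that they do preserve. *)
Definition euclidean_ball (R : realType) m : set 'cV[R]_m :=
  [set x | \sum_i x i 0 ^+ 2 <= 1].

Lemma sum_sqr_tr (R : realType) m (x : 'cV[R]_m) :
  \sum_i x i 0 ^+ 2 = (x^T *m x) 0 0.
Proof. by rewrite mxE; apply: eq_bigr => i _; rewrite mxE expr2. Qed.

Lemma lebesgue_euclidean_ball (R : realType) m :
  measurable (@euclidean_ball R m : set (borel 'cV[R]_m)) /\
  exists2 r : R, 0 < r & @lebesgue_cV R m (@euclidean_ball R m) = r%:E.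
Proof.
have [mu muE muB] := lebesgue_cV_measure R m.
have mB : measurable (@euclidean_ball R m : set (borel 'cV[R]_m)).
  apply: measurable_closed_borel.
  apply: (@preimage_closed _ _ (fun x : 'cV[R]_m => \sum_i x i 0 ^+ 2) [set r | r <= 1]); last exact: closed_le.
  by move=> x _; apply: continuous_sumr => k; apply: continuous_mulr; exact: coord_continuous.
split => //.
(* Radius 2, because the cube is open and the unit ball has points of maximum norm 1. *)
have le2 : (mu (@euclidean_ball R m) <= ((2 *+ 2) ^+ m)%:E)%E.
  rewrite -muB//; apply: le_measure; rewrite ?inE//.
    by apply: measurable_open_borel; exact: ball_open.
  move=> x Bx; apply/ball_cV0 => // i.
  rewrite (@le_lt_trans _ _ 1)// ?ltr1n// -(@expr_le1 _ 2)// real_normK ?num_real//.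
  apply: le_trans Bx; rewrite (bigD1 i)//= lerDl; apply: sumr_ge0 => k _.
  exact: sqr_ge0.
(* If all [|x i 0|] are below [1 / (m + 1)], each square is at most [1 / (m + 1)], and there are [m]
   of them. This choice also covers [m = 0]. *)
have ge2 : (((m.+1%:R^-1 *+ 2) ^+ m)%:E <= mu (@euclidean_ball R m))%E.
  rewrite -muB//; apply: le_measure; rewrite ?inE//.
    by apply: measurable_open_borel; exact: ball_open.
  move=> x /(ball_cV0 _ _)-/(_ _)/wrap[//|h].
  rewrite /euclidean_ball/=; apply: (@le_trans _ _ (\sum_(i < m) m.+1%:R^-1)).
    apply: ler_sum => i _; rewrite -(@real_normK _ (x i 0)) ?num_real// expr2.
    rewrite -[leRHS]mulr1 ler_pM// ltW//; apply: (lt_le_trans (h i)) => //.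
    by rewrite invf_le1// ler1n.
  rewrite sumr_const card_ord -[leLHS]mulr_natl ler_pdivrMr// mul1r ler_nat.
  exact: leqnSn.
rewrite -muE; exists (fine (mu (@euclidean_ball R m))).
  rewrite fine_gt0// (lt_le_trans _ ge2)/= ?lte_fin ?exprn_gt0 ?mulrn_wgt0//.
  by rewrite (le_lt_trans le2)// ltry.
by rewrite fineK// ge0_fin_numE// (le_lt_trans le2)// ltry.
Qed.

(* The image of Lebesgue measure under [Q] is translation invariant, and the
   invariance of the Euclidean ball determines the proportionality constant. *)
Lemma lebesgue_cV_orthogonal (R : realType) m (Q : 'M[R]_m) (A : set (borel 'cV[R]_m)) :
  Q^T *m Q = 1%:M -> measurable A ->
  @lebesgue_cV R m ((fun x : 'cV[R]_m => Q *m x) @^-1` A) = @lebesgue_cV R m A.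
Proof.
move=> QQ mA.
have [la laE laB] := lebesgue_cV_measure R m.
have cQ : continuous (fun x : 'cV[R]_m => Q *m x) by exact: mulmx_continuous.
have QQ' : Q *m Q^T = 1%:M by exact: mulmx1C.
have [mu0 mu0E] := pushforward_measureP la (continuous_borel_measurable cQ).
have [mu muE] : exists mu : {sigma_finite_measure set (borel 'cV[R]_m) -> \bar R}, mu = mu0 :> (set _ -> \bar R).
  apply: sigma_finite_measureP.
  have [F FT mF] := sigma_finiteT la.
  have cQT : continuous (fun x : 'cV[R]_m => Q^T *m x) by exact: mulmx_continuous.
  exists (fun n => (fun x : 'cV[R]_m => Q^T *m x) @^-1` F n).
    by rewrite -preimage_bigcup -FT.
  move=> i; split.
    rewrite -[X in measurable X]setTI; apply: (continuous_borel_measurable cQT) => //.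
    by have [] := mF i.
  rewrite mu0E /pushforward -comp_preimage (_ : _ \o _ = id) ?preimage_id; first by have [] := mF i.
  by apply/funext => x /=; rewrite mulmxA QQ mul1mx.
have mQE X : mu X = la ((fun x : 'cV[R]_m => Q *m x) @^-1` X) by rewrite muE mu0E.
have tla : translation_invariant_measure la by rewrite laE; exact: lebesgue_cV_translation.
have tmu : translation_invariant_measure mu.
  move=> t X mX; rewrite !mQE.
  rewrite -(tla (Q^T *m t) ((fun x : 'cV[R]_m => Q *m x) @^-1` X)); last first.
    by rewrite -[X in measurable X]setTI; apply: (continuous_borel_measurable cQ).
  congr (la _); apply/seteqP; split=> x; by rewrite /preimage/= mulmxDr mulmxA QQ' mul1mx.
have [mB [r r0 laBr]] := @lebesgue_euclidean_ball R m.
have muBr : mu (@euclidean_ball R m) = r%:E.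
  rewrite mQE -laBr laE; congr (lebesgue_cV _).
  have QE (x : 'cV[R]_m) : \sum_i (Q *m x) i 0 ^+ 2 = \sum_i x i 0 ^+ 2.
    by rewrite !sum_sqr_tr trmx_mul mulmxA -(mulmxA _ Q^T) QQ mulmx1.
  by apply/seteqP; split=> x; rewrite /preimage/euclidean_ball/= QE.
have laBr' : la (@euclidean_ball R m) = r%:E by rewrite laE.
have cancelr (x y : \bar R) : (x * r%:E = y * r%:E -> x = y)%E.
  by move=> /(congr1 (fun z => (z * r^-1%:E)%E)); rewrite -!muleA -EFinM divff ?gt_eqF// !mule1.
(* The reflection identity is used for the pair [la], [mu] and for the pair [mu], [mu]. Both times
   the ball cancels and the same reflected set appears on the right, so [la A = mu A]. *)
have e1 : la A = mu (-%R @^-1` A).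
  by apply: cancelr; have := translation_invariant_reflection tla tmu mA mB; rewrite muBr laBr'.
have e2 : mu A = mu (-%R @^-1` A).
  by apply: cancelr; have := translation_invariant_reflection tmu tmu mA mB; rewrite muBr.
by rewrite -laE -mQE e2.
Qed.

(** * The Gaussian measure on a span *)

Section density.
Local Open Scope ereal_scope.
Context d (T : measurableType d) (R : realType) (mu : {measure set T -> \bar R}).
Variables (g : T -> R) (c : {nonneg R}).
Hypotheses (mg : measurable_fun setT g) (g0 : forall x, (0 <= g x)%R).

(** The constant stays outside the integral, as in [gaussian_span], so that the two agree by
    unfolding. *)
Definition density_measure (A : set T) : \bar R :=
  c%:num%:E * \int[mu]_(x in A) (g x)%:E.
Let nu := density_measure.

Let nu0 : nu set0 = 0.
Proof. by rewrite /nu /density_measure integral_set0 mule0. Qed.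

Let nu_ge0 A : 0 <= nu A.
Proof. by apply: mule_ge0 => //; apply: integral_ge0 => x _; rewrite lee_fin. Qed.

Let nu_sigma_additive : semi_sigma_additive nu.
Proof.
move=> F mF tF mUF; rewrite /nu /density_measure.
rewrite ge0_integral_bigcup//; last 2 first.
  by apply: measurable_funTS; exact/measurable_EFinP.
  by move=> x _; rewrite lee_fin.
rewrite [X in X @ _ --> _](_ : _ = fun n =>
    c%:num%:E * \sum_(0 <= i < n) \int[mu]_(x in F i) (g x)%:E); last first.
  apply/funext => n; rewrite ge0_sume_distrr// => i _.
  by apply: integral_ge0 => x _; rewrite lee_fin.
apply: cvgeZl => //; apply: is_cvg_ereal_nneg_natsum_cond => n _ _.
by apply: integral_ge0 => x _; rewrite lee_fin.
Qed.

HB.instance Definition _ := isMeasure.Build _ _ _ nu nu0 nu_ge0 nu_sigma_additive.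

Import HBNNSimple.

(** Both sides are limits over the same simple functions by monotone convergence, and for an
    indicator the identity is the definition of the measure. *)
Lemma ge0_integral_density_measure (f : T -> \bar R) :
  measurable_fun setT f -> (forall x, 0 <= f x) ->
  \int[nu]_x f x = \int[mu]_x (f x * (c%:num * g x)%:E).
Proof.
move=> mf f0.
have mcg : measurable_fun setT (fun x => (c%:num * g x)%:E).
  by apply/measurable_EFinP; exact: measurable_funM.
have cg0 x : 0 <= (c%:num * g x)%:E by rewrite lee_fin mulr_ge0.
pose h := nnsfun_approx measurableT mf.
have -> : \int[nu]_x f x = limn (fun n => \int[nu]_x (h n x)%:E).
  rewrite -monotone_convergence//.
  - apply: eq_integral => x _; apply/esym/cvg_lim => //.
    exact: cvg_nnsfun_approx.
  - by move=> n; exact/measurable_EFinP/measurable_funP.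
  - by move=> n x _; rewrite lee_fin.
  - by move=> x _ a b ab; rewrite lee_fin; exact/lefP/nd_nnsfun_approx.
have -> : \int[mu]_x (f x * (c%:num * g x)%:E) =
    limn (fun n => \int[mu]_x ((h n x)%:E * (c%:num * g x)%:E)).
  rewrite -monotone_convergence//.
  - apply: eq_integral => x _; apply/esym/cvg_lim => //.
    by apply: cvgeZr => //; exact: cvg_nnsfun_approx.
  - by move=> n; apply: emeasurable_funM => //; exact/measurable_EFinP/measurable_funP.
  - by move=> n x _; rewrite mule_ge0// lee_fin.
  - by move=> x _ a b ab; rewrite lee_wpmul2r// lee_fin; exact/lefP/nd_nnsfun_approx.
congr (limn _); apply/funext => n.
transitivity (\int[nu]_x (\sum_(y \in range (h n)) (y * \1_(h n @^-1` [set y]) x)%:E)).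
  by apply: eq_integral => t _; rewrite /= fimfunE -fsumEFin.
have mi r : measurable_fun setT (fun x => (r * \1_(h n @^-1` [set r]) x)%:E).
  by apply/measurable_EFinP; exact: measurable_funM.
rewrite ge0_integral_fsum//; last by move=> y x _; exact: nnfun_muleindic_ge0.
transitivity (\int[mu]_x (\sum_(y \in range (h n))
    (y * \1_(h n @^-1` [set y]) x)%:E * (c%:num * g x)%:E)); last first.
  apply: eq_integral => x _.
  rewrite -ge0_mule_fsuml => [|y]; last exact: nnfun_muleindic_ge0.
  by rewrite fsumEFin // -(fimfunE _ x).
rewrite ge0_integral_fsum//; last 2 first.
- by move=> y; apply: emeasurable_funM.
- by move=> y x _; rewrite mule_ge0// nnfun_muleindic_ge0.
apply: eq_fsbigr => r _.
have mr : measurable (h n @^-1` [set r]) by exact: measurable_sfunP.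
rewrite integralZl_indic_nnsfun// integral_indic// setIT.
(* A negative [r] is not a value of the simple function, so its preimage is empty and both sides
   vanish. *)
have [r0|r0] := leP 0%R r; last first.
  rewrite preimage_nnfun0//= measure0 mule0 integral0_eq// => x _.
  by rewrite indic0 mulr0 mul0e.
under [RHS]eq_integral do rewrite -EFinM -mulrA EFinM.
rewrite ge0_integralZl//; last 2 first.
- apply/measurable_EFinP; apply: measurable_funM; first exact: measurable_indic.
  exact: measurable_funM.
- by move=> x _; rewrite lee_fin !mulr_ge0.
congr (_ * _); rewrite /nu /density_measure.
under [RHS]eq_integral do rewrite mulrCA EFinM.
rewrite ge0_integralZl//; last 2 first.
- by apply/measurable_EFinP; exact: measurable_funM.
- by move=> x _; rewrite lee_fin mulr_ge0.
congr (_ * _); rewrite integral_mkcond; apply: eq_integral => x _.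
by rewrite patchE indicE; case: ifPn => _; rewrite ?mul1r ?mul0r.
Qed.

Lemma density_measureP :
  exists2 ga : {measure set T -> \bar R}, ga = density_measure :> (set T -> \bar R) &
    forall f : T -> \bar R, measurable_fun setT f -> (forall x, 0 <= f x) ->
      \int[ga]_x f x = \int[mu]_x (f x * (c%:num * g x)%:E).
Proof. by exists nu => //; exact: ge0_integral_density_measure. Qed.

End density.

Section finite_measure_of.
Context d (T : measurableType d) (R : realType) (mu : {measure set T -> \bar R}).
Hypothesis mu_fin : (mu setT < +oo)%E.

Definition finite_measure_of (A : set T) : \bar R := mu A.
Let m : set T -> \bar R := finite_measure_of.

Let m0 : m set0 = 0%E. Proof. exact: measure0. Qed.
Let m_ge0 A : (0 <= m A)%E. Proof. exact: measure_ge0. Qed.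
Let m_sigma_additive : semi_sigma_additive m.
Proof. exact: measure_semi_sigma_additive. Qed.

HB.instance Definition _ := isMeasure.Build _ _ _ m m0 m_ge0 m_sigma_additive.

Let m_fin : fin_num_fun m.
Proof.
move=> A mA; rewrite ge0_fin_numE//; apply: le_lt_trans mu_fin.
by apply: le_measure; rewrite ?inE.
Qed.

HB.instance Definition _ := Measure_isFinite.Build _ _ _ m m_fin.

Lemma finite_measureP :
  exists mu' : {finite_measure set T -> \bar R}, mu' = mu :> (set T -> \bar R).
Proof. by exists m. Qed.

End finite_measure_of.

Lemma gaussian_exp_lty (R : realType) (b : R) :
  (\int[@lebesgue_measure R]_t (expR (b * `|t| - t ^+ 2 / 2))%:E < +oo)%E.
Proof.
(* Half of [t ^+ 2 / 2] absorbs the linear term: [b |t| <= b^2 + t^2 / 4], because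
   [(|b| - |t| / 2)^2 >= 0]. What remains is [exp (- t^2 / 4)], a normal density of variance 2 up to
   its peak value; [C] collects the constants. *)
pose s : R := Num.sqrt 2.
have s0 : s != 0 by rewrite gt_eqF// sqrtr_gt0.
have s2 : s ^+ 2 = 2 by rewrite sqr_sqrtr.
pose C := expR (b ^+ 2) / normal_peak s.
have C0 : 0 <= C by rewrite divr_ge0// ?expR_ge0// normal_peak_ge0.
have mh : measurable_fun setT (fun t : R => (expR (b * `|t| - t ^+ 2 / 2))%:E).
  apply/measurable_EFinP; apply: measurableT_comp => //; apply: measurable_funB.
    by apply: measurable_funM => //; exact: measurableT_comp.
  by apply: measurable_funM => //; exact: measurable_funX.
have mn : measurable_fun setT (fun t : R => (normal_pdf 0 s t)%:E).
  by apply/measurable_EFinP; exact: measurable_normal_pdf.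
apply: (@le_lt_trans _ _ (\int[@lebesgue_measure R]_t (C%:E * (normal_pdf 0 s t)%:E)))%E.
  apply: ge0_le_integral => //.
  - by apply: emeasurable_funM.
  - move=> t _; rewrite -EFinM lee_fin /C normal_pdfE// mulrA divfK; last first.
      by rewrite gt_eqF// normal_peak_gt0.
    rewrite /normal_fun -expRD ler_expR subr0 s2.
    rewrite -(@real_normK _ t) ?num_real// -(@real_normK _ b) ?num_real//.
    have := ler_norm b; have := normr_ge0 t; have := normr_ge0 b.
    move: `|t| `|b| => x y y0 x0 yb.
    have : b * x <= y * x by rewrite ler_wpM2r.
    have := sqr_ge0 (y - x / 2).
    rewrite !expr2; lra.
rewrite ge0_integralZl ?lee_fin//; last by move=> t _; rewrite lee_fin normal_pdf_ge0.
by rewrite integral_normal_pdf// mule1 ltry.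
Qed.

Lemma borel_measurable_funR d (T : measurableType d) (R : realType) (D : set T) (f : T -> R) :
  measurable D -> (forall B : set R, open B -> measurable (D `&` f @^-1` B)) ->
  measurable_fun D f.
Proof.
move=> mD h; apply: (measurability _ (RGenOInfty.measurableE R)).
by move=> _ [_ [x ->] <-]; apply: h; exact: interval_open.
Qed.

Lemma continuous_borel_measurableR (R : realType) (U : ptopologicalType) (f : U -> R) :
  continuous f -> measurable_fun setT (f : borel U -> R).
Proof.
move=> /continuousP cf; apply: borel_measurable_funR => // A oA; rewrite setTI.
by apply: measurable_open_borel; exact: cf.
Qed.

Lemma integral_lebesgue_cV_prod (R : realType) m (h : R -> R) :
  measurable_fun setT h -> (forall t, 0 <= h t) ->
  (\int[@lebesgue_measure R]_t (h t)%:E < +oo)%E ->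
  (\int[@lebesgue_cV R m]_x (\prod_i h ((x : 'cV[R]_m) i 0))%:E < +oo)%E.
Proof.
move=> mh h0 hoo.
have mP k : measurable_fun setT (fun x : borel 'cV[R]_k => \prod_i h ((x : 'cV[R]_k) i 0)).
  apply: measurable_prod => i _.
  apply: (measurableT_comp mh).
  exact: (continuous_borel_measurableR (@coord_continuous R k 1 i 0)).
have P0 k (x : 'cV[R]_k) : 0 <= \prod_i h (x i 0) by apply: prodr_ge0.
elim: m => [|m IH].
  have [mu muE muB] := lebesgue_cV_measure R 0.
  have : (\int[mu]_x 1 < +oo)%E.
    have bT : [set: 'cV[R]_0] = ball 0 1.
      by apply/seteqP; split=> // x _; apply/ball_cV0 => // -[].
    have muT : mu [set: borel 'cV[R]_0] = ((1 *+ 2) ^+ 0)%:E := etrans (congr1 mu bT) (muB 1 ltr01).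
    by rewrite integral_cst// mul1e; have := ltry ((1 *+ 2 : R) ^+ 0); rewrite -muT.
  by rewrite muE; under [X in _ -> (X < _)%E]eq_integral do rewrite big_ord0.
have [mu muE muB] := lebesgue_cV_measure R m.
rewrite /= -muE in IH *.
pose F (x : borel 'cV[R]_m.+1) : \bar R := (\prod_i h ((x : 'cV[R]_m.+1) i 0))%:E.
pose f (x : borel 'cV[R]_m) : \bar R := (\prod_i h ((x : 'cV[R]_m) i 0))%:E.
have mF : measurable_fun setT F by apply/measurable_EFinP; exact: (mP m.+1).
have mf : measurable_fun setT f by apply/measurable_EFinP; exact: (mP m).
have F0 x : (0 <= F x)%E by rewrite lee_fin; exact: (P0 m.+1).
have f0 x : (0 <= f x)%E by rewrite lee_fin; exact: (P0 m).
rewrite -/F -/f in IH *.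
rewrite (ge0_integral_pushforward (@measurable_col_mx R m) (lebesgue_measure \x mu)%E _ mF)//.
rewrite preimage_setT.
have hE (x : R) (v : 'cV[R]_m) : F (col_mx (x%:M : 'M[R]_1) v) = ((h x)%:E * f v)%E.
  rewrite /F /f -EFinM big_ord_recl; congr (h _ * _)%:E.
    rewrite (_ : ord0 = (lshift m 0 : 'I_(1 + m))); last exact/val_inj.
    by rewrite (@col_mxEu _ 1 m) mxE eqxx.
  apply: eq_bigr => i _; congr (h _).
  rewrite (_ : lift ord0 i = (rshift 1 i : 'I_(1 + m))); last exact/val_inj.
  by rewrite (@col_mxEd _ 1 m).
have mFc := measurableT_comp mF (@measurable_col_mx R m).
rewrite (fubini_tonelli1 _ mFc)//; last by move=> x; exact: F0.
rewrite /fubini_F /=.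
under eq_integral => x _.
  under eq_integral do rewrite hE.
  rewrite ge0_integralZl ?lee_fin//.
  over.
rewrite ge0_integralZr//; last 3 first.
- exact/measurable_EFinP.
- by move=> x _; rewrite lee_fin.
- exact: integral_ge0.
have I0 : (0 <= \int[@lebesgue_measure R]_x (h x)%:E)%E by apply: integral_ge0 => t _; rewrite lee_fin.
by apply: lte_mul_pinfty => //; rewrite ge0_fin_numE.
Qed.

(** * Frobenius inner product and coordinates in an orthonormal family *)

Section frobenius.
Context {R : realType} {n : nat}.
Implicit Types X Y : 'M[R]_n.

Lemma frob_innerE X Y : frob_inner X Y = \sum_i \sum_j X j i * Y j i.
Proof.
rewrite /frob_inner /mxtrace; apply: eq_bigr => i _; rewrite mxE.
by apply: eq_bigr => j _; rewrite mxE.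
Qed.

Lemma frob_innerC X Y : frob_inner X Y = frob_inner Y X.
Proof. by rewrite !frob_innerE; apply: eq_bigr => i _; apply: eq_bigr => j _; rewrite mulrC. Qed.

Lemma frob_inner_suml m (a : 'I_m -> R) (E : 'I_m -> 'M[R]_n) Y :
  frob_inner (\sum_i a i *: E i) Y = \sum_i a i * frob_inner (E i) Y.
Proof.
rewrite /frob_inner linear_sum/= mulmx_suml raddf_sum/=; apply: eq_bigr => i _.
by rewrite linearZ/= -scalemxAl mxtraceZ.
Qed.

Lemma frob_inner_sumr m (a : 'I_m -> R) (E : 'I_m -> 'M[R]_n) Y :
  frob_inner Y (\sum_i a i *: E i) = \sum_i a i * frob_inner Y (E i).
Proof. by rewrite frob_innerC frob_inner_suml; apply: eq_bigr => i _; rewrite frob_innerC. Qed.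

End frobenius.

Definition span_map (R : realType) n d (e : d.-tuple 'M[R]_n) (x : 'cV[R]_d) : 'M[R]_n :=
  \sum_(i < d) x i 0 *: tnth e i.

Lemma continuous_span_map (R : realType) n d (e : d.-tuple 'M[R]_n) : continuous (span_map e).
Proof.
apply: continuous_mx => i j; rewrite /span_map.
under eq_fun => x do (rewrite summxE; under eq_bigr do rewrite mxE).
apply: continuous_sumr => k; apply: continuous_mulr; last exact: cst_continuous.
exact: coord_continuous.
Qed.

Lemma frob_span_map (R : realType) n d (e : d.-tuple 'M[R]_n) x :
  (forall i j : 'I_d, frob_inner (tnth e i) (tnth e j) = (i == j)%:R) ->
  frob_inner (span_map e x) (span_map e x) = \sum_i x i 0 ^+ 2.
Proof.
move=> he; rewrite /span_map frob_inner_suml; apply: eq_bigr => i _.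
rewrite frob_inner_sumr (bigD1 i)//= he eqxx mulr1 big1 ?addr0 ?expr2// => j ji.
by rewrite he eq_sym (negbTE ji) mulr0.
Qed.

Lemma continuous_frob (R : realType) n : continuous (fun X : 'M[R]_n => frob_inner X X).
Proof.
under eq_fun do rewrite frob_innerE.
apply: continuous_sumr => i; apply: continuous_sumr => j.
by apply: continuous_mulr; exact: coord_continuous.
Qed.

Lemma mx_norm_frob (R : realType) n (X : 'M[R]_n) : `|X| ^+ 2 <= frob_inner X X.
Proof.
have F0 : 0 <= frob_inner X X.
  by rewrite frob_innerE; apply: sumr_ge0 => i _; apply: sumr_ge0 => j _; rewrite -expr2 sqr_ge0.
rewrite -(sqr_sqrtr F0) ler_sqr ?nnegrE ?sqrtr_ge0//.
apply: mx_norm_le; first exact: sqrtr_ge0.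
move=> i j; rewrite -sqrtr_sqr ler_wsqrtr// frob_innerE (bigD1 j)//= (bigD1 i)//= expr2.
rewrite -addrA lerDl addr_ge0// sumr_ge0// => k _; rewrite ?sumr_ge0// => *; rewrite -expr2 sqr_ge0//.
Qed.

Section gaussian.
Context {R : realType} {n d : nat} (e : d.-tuple 'M[R]_n).
Hypothesis he : forall i j : 'I_d, frob_inner (tnth e i) (tnth e j) = (i == j)%:R.

Let g (X : 'M[R]_n) : R := expR (- (2^-1 * frob_inner X X)).
Let c : {nonneg R} := NngNum (powR_ge0 (2 * pi) (- (d%:R / 2))).

Let mg : measurable_fun setT (g : borel 'M[R]_n -> R).
Proof.
apply: (measurableT_comp (@measurable_expR R)).
apply: measurableT_comp => //; apply: measurable_funM => //.
by apply: continuous_borel_measurableR; exact: continuous_frob.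
Qed.

Let g0 X : 0 <= g X. Proof. exact: expR_ge0. Qed.

Let mspan : measurable_fun setT (span_map e : borel 'cV[R]_d -> borel 'M[R]_n).
Proof. by apply: continuous_borel_measurable; exact: continuous_span_map. Qed.

Lemma gaussian_span_measure :
  exists2 ga : {measure set (borel 'M[R]_n) -> \bar R},
    ga = gaussian_span e :> (set _ -> \bar R) &
    forall f : borel 'M[R]_n -> \bar R, measurable_fun setT f -> (forall X, 0 <= f X)%E ->
      (\int[ga]_X f X =
       \int[@lebesgue_cV R d]_x (f (span_map e x) * (c%:num * g (span_map e x))%:E))%E.
Proof.
have [la laE _] := lebesgue_cV_measure R d.
have [m mE] := pushforward_measureP la mspan.
have [ga gaE gaint] := density_measureP m c mg g0.
exists ga.
  have mE' : m = lebesgue_span e :> (set _ -> \bar R) by rewrite mE /lebesgue_span -laE.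
  by apply/funext => A; rewrite gaE /gaussian_span /density_measure mE'.
move=> f mf f0; rewrite gaint// mE.
rewrite ge0_integral_pushforward//; last 2 first.
- apply: emeasurable_funM => //; apply/measurable_EFinP; exact: measurable_funM.
- by move=> x _; rewrite mule_ge0// lee_fin mulr_ge0.
by rewrite -laE preimage_setT.
Qed.

(** The maximum norm of [span_map e x] is at most its Frobenius norm, hence at most the sum of the
    [|x i 0|]. The integrand is therefore dominated by a product of functions of one coordinate,
    each with finite integral. *)
Lemma gaussian_span_exp :
  exists2 ga : {finite_measure set (borel 'M[R]_n) -> \bar R},
    ga = gaussian_span e :> (set _ -> \bar R) &
    forall a : R, 0 <= a -> (\int[ga]_X (expR (a * `|X : 'M[R]_n|))%:E < +oo)%E.
Proof.
have [la laE _] := lebesgue_cV_measure R d.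
have [ga gaE gaint] := gaussian_span_measure.
have bound a : 0 <= a -> (\int[ga]_X (expR (a * `|X : 'M[R]_n|))%:E < +oo)%E.
  move=> a0.
  have mn : measurable_fun setT (fun X : borel 'M[R]_n => (expR (a * `|X : 'M[R]_n|))%:E).
    apply/measurable_EFinP; apply: (measurableT_comp (@measurable_expR R)).
    by apply: measurable_funM => //; apply: continuous_borel_measurableR; exact: norm_continuous.
  rewrite gaint//.
  pose h (t : R) := expR (a * `|t| - t ^+ 2 / 2).
  have mh : measurable_fun setT h.
    apply: measurableT_comp => //; apply: measurable_funB.
      by apply: measurable_funM => //; exact: measurableT_comp.
    by apply: measurable_funM => //; exact: measurable_funX.
  have h0 t : 0 <= h t by exact: expR_ge0.
  have mP : measurable_fun setT (fun x : borel 'cV[R]_d => \prod_i h ((x : 'cV[R]_d) i 0)).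
    apply: measurable_prod => i _; apply: (measurableT_comp mh).
    exact: (continuous_borel_measurableR (@coord_continuous R d 1 i 0)).
  have I := integral_lebesgue_cV_prod d mh h0 (gaussian_exp_lty a).
  rewrite -laE in I *.
  apply: (@le_lt_trans _ _ (\int[la]_x (c%:num%:E * (\prod_i h ((x : 'cV[R]_d) i 0))%:E))%E).
    apply: ge0_le_integral => //.
    - by move=> x _; rewrite -EFinM lee_fin !mulr_ge0 ?expR_ge0.
    - apply: emeasurable_funM; first exact: (measurableT_comp mn mspan).
      by apply/measurable_EFinP; apply: measurable_funM => //; exact: (measurableT_comp mg mspan).
    - by apply: emeasurable_funM => //; exact/measurable_EFinP.
    - move=> x _; rewrite -!EFinM lee_fin mulrCA ler_wpM2l// /h /g -expRD -expR_sum ler_expR.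
      rewrite frob_span_map// sumrB -mulr_sumr -mulr_suml (mulrC 2^-1) lerD2r ler_wpM2l//.
      have := mx_norm_frob (span_map e x); rewrite frob_span_map// => H.
      (* After squaring, it remains that the sum of the squares is at most the square of the sum of
         the absolute values, by induction on the list of indices. *)
      rewrite -(@ler_pXn2r _ 2)// ?nnegrE// ?sumr_ge0//; apply: (le_trans H).
      have S0 (r : seq 'I_d) : 0 <= \sum_(i <- r) `|x i 0| by exact: sumr_ge0.
      elim: (index_enum _) => [|i r IH]; first by rewrite !big_nil expr0n.
      rewrite !big_cons sqrrD real_normK ?num_real// -addrA lerD2l.
      by rewrite (le_trans IH)// lerDr mulrn_wge0// mulr_ge0.
  rewrite ge0_integralZl//; last 2 first.
    exact/measurable_EFinP.
    by move=> x _; rewrite lee_fin prodr_ge0.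
  by apply: lte_mul_pinfty; rewrite ?lee_fin.
have [ga' ga'E] : exists ga' : {finite_measure set (borel 'M[R]_n) -> \bar R}, ga' = ga :> (set _ -> \bar R).
  (* The exponent 0 of the moment bound gives finiteness of the total mass. *)
  apply: finite_measureP; have := bound 0 (lexx _).
  under eq_integral do rewrite mul0r expR0.
  by rewrite integral_cst// mul1e.
by exists ga'; rewrite ga'E.
Qed.

(** In the coordinates given by [e] the map acts as [Q], which preserves Lebesgue measure, and the
    density depends only on the Euclidean length of the coordinates. *)
Lemma gaussian_span_invariant (F : 'M[R]_n -> 'M[R]_n) (Q : 'M[R]_d) (A : set (borel 'M[R]_n)) :
  Q^T *m Q = 1%:M -> (forall x, F (span_map e x) = span_map e (Q *m x)) ->
  measurable A -> measurable (F @^-1` A : set (borel 'M[R]_n)) ->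
  gaussian_span e (F @^-1` A) = gaussian_span e A.
Proof.
move=> QQ FQ mA mFA.
have [la laE _] := lebesgue_cV_measure R d.
have [ga gaE gaint] := gaussian_span_measure.
have gaA B : measurable B -> ga B = (\int[la]_x ((\1_B (span_map e x))%:E * (c%:num * g (span_map e x))%:E))%E.
  move=> mB; rewrite laE -(gaint (fun X => (\1_B X)%:E))//; last by apply/measurable_EFinP; exact: measurable_indic.
  by rewrite integral_indic// setIT.
rewrite -gaE !gaA//.
have cQ : continuous (fun x : 'cV[R]_d => Q *m x) by exact: mulmx_continuous.
have mQ := continuous_borel_measurable cQ.
pose f (x : borel 'cV[R]_d) := ((\1_A (span_map e x))%:E * (c%:num * g (span_map e x))%:E)%E.
transitivity (\int[la]_x (f \o (fun x : borel 'cV[R]_d => Q *m x : borel 'cV[R]_d)) x)%E.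
  apply: eq_integral => x _; rewrite /f /= -FQ; congr (_ * (_ * _)%:E)%E.
  rewrite /g FQ !frob_span_map// !sum_sqr_tr trmx_mul mulmxA -(mulmxA _ Q^T) QQ mulmx1//.
rewrite -[in LHS](@preimage_setT _ _ (fun x : borel 'cV[R]_d => Q *m x : borel 'cV[R]_d)).
rewrite -(ge0_integral_pushforward mQ)//; last 2 first.
- apply: emeasurable_funM; apply/measurable_EFinP.
    exact: (measurableT_comp (measurable_indic mA) mspan).
  by apply: measurable_funM => //; exact: (measurableT_comp mg mspan).
- by move=> x _; rewrite /f -EFinM lee_fin !mulr_ge0.
apply: eq_measure_integral => C mC _; rewrite /pushforward.
by have := lebesgue_cV_orthogonal QQ mC; rewrite -laE.
Qed.

End gaussian.

(** * Convex bodies *)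

Section ultrafilters.

(** Limits along a non-principal ultrafilter replace passage to subsequences: one [U] serves all
    sequences at once, so no diagonal extraction occurs. *)
Lemma nat_ultrafilter :
  exists U : set_system nat, UltraFilter U /\ eventually `<=` U.
Proof. exact: ultraFilterLemma. Qed.

Context {R : realType} {V : normedModType R} (U : set_system nat).
Hypothesis UU : UltraFilter U.

Lemma ultra_seq_cvg (C : set V) (y : nat -> V) :
  compact C -> U [set m | C (y m)] ->
  exists2 p, C p & forall e : R, 0 < e -> U [set m | `|p - y m| < e].
Proof.
move=> cC UC.
have [p [Cp clp]] := cC (y @ U) _ UC.
exists p => // e e0.
(* Otherwise [U] contains the set of indices with [y m] far from [p], and the cluster point [p]
   would be adherent to the corresponding values. *)
have [//|Un] := in_ultra_setVsetC [set m | `|p - y m| < e] UU.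
have : nbhs p (ball p e) by exact: nbhsx_ballx.
move=> /(clp (y @` (~` [set m | `|p - y m| < e])) (ball p e))[].
  suff : U (y @^-1` (y @` (~` [set m | `|p - y m| < e]))) by [].
  by apply: filterS Un => m h; exists m.
by move=> _ [[m h <-]]; rewrite -ball_normE.
Qed.

Lemma ultra_notP (P : nat -> Prop) : ~ U [set m | P m] -> U [set m | ~ P m].
Proof. by have [] := in_ultra_setVsetC [set m | P m] UU. Qed.

Lemma ultra_ex (A : set nat) : U A -> exists m, A m.
Proof. by move=> UA; apply: filter_ex UA. Qed.

End ultrafilters.

Lemma convex_setP (R : realType) (V : lmodType R) (A : set V) :
  convex_set (A : set (convex_lmodType V)) <->
  forall x y (s : R), 0 <= s <= 1 -> A x -> A y -> A (s *: x + (1 - s) *: y).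
Proof.
split=> [cA x y s /andP[s0 s1] Ax Ay|cA x y l /set_mem Ax /set_mem Ay].
  by have /set_mem := cA x y (Itv01 s0 s1) (mem_set Ax) (mem_set Ay).
by apply/mem_set; apply: (cA x y l%:num) => //; apply/andP.
Qed.

(* For the maximum norm; on convex bodies this induces the same topology as
   the Euclidean Hausdorff distance. *)
Definition close_sets (R : realType) (V : normedModType R) (r : R) (A B : set V) :=
  (forall x, A x -> exists2 y, B y & `|x - y| <= r) /\
  (forall y, B y -> exists2 x, A x & `|x - y| <= r).

Lemma continuous_addr (R : realType) (T : topologicalType) (V : normedModType R) (f g : T -> V) :
  continuous f -> continuous g -> continuous (fun x => f x + g x).
Proof. by move=> cf cg x; apply: cvgD; [exact: cf|exact: cg]. Qed.

Section convex_bodies.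
Context {R : realType} {n : nat}.
Local Notation V := 'cV[R]_n.
Implicit Types (A B C : set V) (L M : convex_body R n) (phi : convex_body R n -> R).

Lemma body_ext L M : body_set L = M -> L = M.
Proof.
case: L M => A hA [B hB] /= AB; rewrite -AB in hB *.
by congr ConvexBody; exact: Prop_irrelevance.
Qed.

Lemma extend0E phi A (hA : is_convex_body A) : extend0 phi A = phi (ConvexBody hA).
Proof.
rewrite /extend0; case: pselect => // hA'.
by congr phi; exact: body_ext.
Qed.

Lemma extend0_empty phi A : A = set0 -> extend0 phi A = 0.
Proof. by move=> ->; rewrite /extend0; case: pselect => // -[[]]. Qed.

Lemma mulmx_norm_le m p (g : 'M[R]_(n, m)) (x : 'M[R]_(m, p)) : `|g *m x| <= m%:R * `|g| * `|x|.
Proof.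
apply: mx_norm_le => [|i j]; first by rewrite !mulr_ge0.
rewrite mxE; apply: (le_trans (ler_norm_sum _ _ _)).
rewrite -mulrA mulr_natl -[X in _ *+ X](card_ord m) -sumr_const; apply: ler_sum => k _.
by rewrite normrM ler_pM// ler_mx_norm.
Qed.

Lemma affine_continuous m (g : 'M[R]_(n, m)) (t : V) : continuous (fun x : 'cV[R]_m => g *m x + t).
Proof. by apply: continuous_addr; [exact: mulmx_continuous|exact: cst_continuous]. Qed.

Lemma affine_image_body (g : 'M[R]_n) (t : V) L : is_convex_body (affine_image g t L).
Proof.
have [[x Lx] cL vL] := body_convex L.
split.
- by exists (g *m x + t), x.
- apply: continuous_compact => //; apply: continuous_subspaceT.
  exact: affine_continuous.
- apply/convex_setP => _ _ s s01 [y Ly <-] [z Lz <-].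
  exists (s *: y + (1 - s) *: z); first by move/convex_setP : vL; apply.
  by rewrite mulmxDr -!scalemxAr !scalerDr addrACA -scalerDl (addrC s) subrK scale1r.
Qed.

Lemma body_closed M : closed (M : set V).
Proof.
have [_ cM _] := body_convex M; apply: compact_closed cM; exact: norm_hausdorff.
Qed.

Lemma body_setI_body M L : (M `&` L : set V) !=set0 -> is_convex_body (M `&` L).
Proof.
have [_ cM /convex_setP vM] := body_convex M.
have [_ cL /convex_setP vL] := body_convex L.
move=> h; split=> //; first by apply: compact_closedI => //; exact: body_closed.
by apply/convex_setP => x y s s01 [? ?] [? ?]; split; [exact: vM|exact: vL].
Qed.

Lemma body_bounded M : exists2 r : R, 0 < r & forall x, (M : set V) x -> `|x| <= r.
Proof.
have [_ cM _] := body_convex M.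
have [r [_ hr]] := compact_bounded cM.
exists (`|r| + 1); first by rewrite ltr_wpDl.
move=> x Mx; apply: (hr (`|r| + 1)) => //.
by rewrite (le_lt_trans (ler_norm r))// ltrDl.
Qed.

Lemma compact_ball_cV (r : R) : compact [set x : V | `|x| <= r].
Proof.
have [r0|r0] := ltP r 0.
  rewrite (_ : [set _ | _] = set0); first exact: compact0.
  by apply/seteqP; split=> // x /= xr; have := le_lt_trans xr r0; rewrite ltNge normr_ge0.
rewrite (_ : [set _ | _] = trmx @` [set v : 'rV[R]_n | forall i, `[- r, r]%classic (v ord0 i)]).
  apply: continuous_compact; last by apply: (@rV_compact _ _ (fun=> `[- r, r]%classic)) => i; exact: segment_compact.
  apply: continuous_subspaceT; apply: continuous_mx => i j.
  by under eq_fun do rewrite mxE; exact: coord_continuous.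
apply/seteqP; split=> [x xr|_ [v hv <-]] /=.
  exists x^T; last by rewrite trmxK.
  by move=> i /=; rewrite mxE in_itv/= -ler_norml; apply: le_trans xr; exact: ler_mx_norm.
apply: mx_norm_le => // i j; rewrite mxE ler_norml ord1.
by have := hv i; rewrite /= in_itv.
Qed.

Lemma euclidean_norm_ge (x : V) : `|x| <= euclidean_norm x.
Proof.
apply: mx_norm_le; first exact: sqrtr_ge0.
move=> i j; rewrite ord1 -sqrtr_sqr /euclidean_norm ler_wsqrtr// (bigD1 i)//= lerDl.
by apply: sumr_ge0 => k _; exact: sqr_ge0.
Qed.

Lemma euclidean_norm_le (x : V) : euclidean_norm x <= n.+1%:R * `|x|.
Proof.
have -> : n.+1%:R * `|x| = Num.sqrt ((n.+1%:R * `|x|) ^+ 2).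
  by rewrite sqrtr_sqr ger0_norm// mulr_ge0.
rewrite /euclidean_norm ler_wsqrtr//.
apply: (@le_trans _ _ (\sum_(i < n) `|x| ^+ 2)).
  apply: ler_sum => i _; rewrite -[leLHS]real_normK ?num_real//.
  by rewrite ler_sqr ?nnegrE// ler_mx_norm.
rewrite sumr_const card_ord -[leLHS]mulr_natl exprMn ler_wpM2r ?sqr_ge0//.
by rewrite -natrX ler_nat (leq_trans (leqnSn n))// -[leqLHS]expn1 leq_pexp2l.
Qed.

Lemma hausdorff_dist_le (r : R) A B : 0 <= r -> close_sets r A B ->
  hausdorff_dist A B <= n.+1%:R * r.
Proof.
move=> r0 [AB BA]; rewrite /hausdorff_dist; apply: ge_inf.
  by exists 0 => s [].
split=> [|x Ax|y By]; first by rewrite mulr_ge0.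
- have [y By xy] := AB _ Ax; exists y => //.
  by apply: (le_trans (euclidean_norm_le _)); rewrite ler_wpM2l.
- have [x Ax xy] := BA _ By; exists x => //.
  by apply: (le_trans (euclidean_norm_le _)); rewrite ler_wpM2l.
Qed.

Lemma hausdorff_dist_close (r : R) M L :
  hausdorff_dist M L < r -> close_sets r (M : set V) L.
Proof.
rewrite /hausdorff_dist; set E := [set _ | _] => h.
have [[x Mx] _ _] := body_convex M; have [[y Ly] _ _] := body_convex L.
have [rM rM0 hM] := body_bounded M; have [rL rL0 hL] := body_bounded L.
have hE : has_inf E.
  split; last by exists 0 => s [].
  have H z w : (M : set V) z -> (L : set V) w -> euclidean_norm (z - w) <= n.+1%:R * (rM + rL).
    move=> Mz Lw; apply: (le_trans (euclidean_norm_le _)); rewrite ler_wpM2l//.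
    by apply: (le_trans (ler_normB _ _)); rewrite lerD// ?hM// hL.
  exists (n.+1%:R * (rM + rL)); split.
  - by rewrite mulr_ge0// addr_ge0// ltW.
  - by move=> z Mz; exists y => //; exact: H.
  - by move=> z Lz; exists x => //; exact: H.
have /(inf_adherent)/(_ hE)[s [s0 h1 h2]] : 0 < r - inf E by rewrite subr_gt0.
rewrite addrC subrK => sr; split => [z /h1[w Lw zw]|z /h2[w Mw zw]].
- by exists w => //; apply: (le_trans (euclidean_norm_ge _)); rewrite (le_trans zw)// ltW.
- by exists w => //; apply: (le_trans (euclidean_norm_ge _)); rewrite (le_trans zw)// ltW.
Qed.

Lemma hausdorff_continuousP phi : hausdorff_continuous phi <->
  forall M (eps : R), 0 < eps -> exists2 delta : R, 0 < delta &
    forall L, close_sets delta (M : set V) L -> `|phi L - phi M| < eps.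
Proof.
split=> h M eps eps0; have [d d0 hd] := h M eps eps0.
  (* The Euclidean and maximum norms differ by a factor of at most [n + 1]; dividing by [n + 2]
     makes the resulting inequality strict. *)
  exists (d / n.+2%:R); first by rewrite divr_gt0.
  move=> L ML; apply: hd; apply: (@le_lt_trans _ _ (n.+1%:R * (d / n.+2%:R))).
    by apply: hausdorff_dist_le => //; rewrite divr_ge0// ltW.
  by rewrite mulrCA gtr_pMr// ltr_pdivrMr// mul1r ltr_nat.
by exists d => // L /hausdorff_dist_close; exact: hd.
Qed.

(* Blaschke selection: the limit of a bounded sequence of bodies along an
   ultrafilter is the set of the limits of their points. *)
Lemma ultra_body_limit (U : set_system nat) (C : set V) (F : nat -> convex_body R n) :
  UltraFilter U -> compact C -> (forall m, (F m : set V) `<=` C) ->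
  exists A : convex_body R n, forall eps : R, 0 < eps ->
    U [set m | close_sets eps (A : set V) (F m)].
Proof.
move=> UU cC FC.
have lim (y : nat -> V) : (forall m, C (y m)) ->
    exists2 p, C p & forall e : R, 0 < e -> U [set m | `|p - y m| < e].
  by move=> Cy; apply: ultra_seq_cvg => //; apply: filterS filterT => m _; exact: Cy.
pose A : set V := [set x | forall e : R, 0 < e -> U [set m | exists2 y, (F m : set V) y & `|x - y| < e]].
have closedC : closed C by apply: compact_closed cC; exact: norm_hausdorff.
have AC : A `<=` C.
  move=> x Ax; apply: closedC => B /nbhs_ballP[e /= e0 xeB].
  have [m [y Fy xy]] := ultra_ex UU (Ax e e0).
  by exists y; split; [exact: FC Fy|apply: xeB; rewrite -ball_normE].
have closedA : closed A.
  move=> x clx e e0; have e2 : 0 < e / 2 by rewrite divr_gt0.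
  have [y [Ay xy]] := clx (ball x (e / 2)) (nbhsx_ballx x (e / 2) e2).
  apply: filterS (Ay _ e2) => m [z Fz yz]; exists z => //.
  rewrite -ball_normE /= in xy; rewrite [e]splitr -(subrKA y).
  by apply: (le_lt_trans (ler_normD _ _)); exact: ltrD.
have memA (y : nat -> V) p : U [set m | (F m : set V) (y m)] ->
    (forall e : R, 0 < e -> U [set m | `|p - y m| < e]) -> A p.
  move=> Fy py e e0; apply: filterS (filterI Fy (py e e0)) => m [? ?].
  by exists (y m).
have pick m : exists y, (F m : set V) y by have [[y Fy] _ _] := body_convex (F m); exists y.
have bodyA : is_convex_body A.
  split; last 1 first.
  - apply/convex_setP => x y s /andP[s0 s1] Ax Ay e e0.
    apply: filterS (filterI (Ax e e0) (Ay e e0)) => m [[x' Fx xx'] [y' Fy yy']].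
    exists (s *: x' + (1 - s) *: y').
      have [_ _ /convex_setP] := body_convex (F m); apply => //; exact/andP.
    rewrite opprD addrACA -!scalerBr.
    apply: (le_lt_trans (ler_normD _ _)); rewrite !normrZ !ger0_norm// ?subr_ge0//.
    (* The strict inequality comes from the first summand, except for [s = 0], where only the second
       one is left. *)
    have [->|sn0] := eqVneq s 0; first by rewrite mul0r add0r subr0 mul1r.
    have sp : 0 < s by rewrite lt_neqAle eq_sym sn0.
    have -> : e = s * e + (1 - s) * e by rewrite -mulrDl addrC subrK mul1r.
    by rewrite ltr_leD// ?ltr_pM2l// ler_wpM2l ?subr_ge0// ltW.
  - have [y Fy] := choice pick.
    have [|p Cp py] := lim y; first by move=> m; exact: FC (Fy m).
    by exists p; apply: memA py; apply: filterS filterT => m _; exact: Fy.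
  - exact: subclosed_compact closedA cC AC.
exists (ConvexBody bodyA) => eps eps0 /=.
have e2 : 0 < eps / 2 by rewrite divr_gt0.
apply: filterI.
(* If this half of the closeness fails, choose for the bad [m] a point [x m] of [A] farther than
   [eps] from [F m], and any point of [A] for the others. The limit [p] of the [x m] lies in [A],
   hence has points of [F m] nearby, and these are also near [x m]. *)
- have [//|/(ultra_notP UU) H] := pselect (U [set m | forall x, A x -> exists2 y, (F m : set V) y & `|x - y| <= eps]).
  have Hx m : exists x, A x /\ (~ (forall x, A x -> exists2 y, (F m : set V) y & `|x - y| <= eps) ->
      forall y, (F m : set V) y -> eps < `|x - y|).
    have [h|h] := pselect (forall x, A x -> exists2 y, (F m : set V) y & `|x - y| <= eps).
      by have [[x Ax] _ _] := bodyA; exists x; split.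
    move/existsNP : (h) => [x /not_implyP[Ax hx]]; exists x; split => // _ y Fy.
    by rewrite ltNge; apply/negP => xy; apply: hx; exists y.
  have [x hx] := choice Hx.
  have [|p Cp px] := lim x; first by move=> m; apply: AC; have [] := hx m.
  have Ap : A p.
    apply: closedA => B /nbhs_ballP[e /= e0 peB].
    have [m pm] := ultra_ex UU (px e e0).
    by exists (x m); split; [have [] := hx m|apply: peB; rewrite -ball_normE].
  have [m [[pm [y Fy py]] nm]] := ultra_ex UU (filterI (filterI (px _ e2) (Ap _ e2)) H).
  have [_ /(_ nm y Fy)] := hx m.
  rewrite -(subrKA p) ltNge (le_trans (ler_normD _ _))// [eps]splitr lerD// ltW//.
  by rewrite distrC.
(* Conversely, bad points [y m] of [F m] have a limit along [U], and this limit is in [A] by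
   construction. *)
- have [//|/(ultra_notP UU) H] := pselect (U [set m | forall y, (F m : set V) y -> exists2 x, A x & `|x - y| <= eps]).
  have Hy m : exists y, (F m : set V) y /\ (~ (forall y, (F m : set V) y -> exists2 x, A x & `|x - y| <= eps) ->
      forall x, A x -> eps < `|x - y|).
    have [h|h] := pselect (forall y, (F m : set V) y -> exists2 x, A x & `|x - y| <= eps).
      by have [y Fy] := pick m; exists y; split.
    move/existsNP : (h) => [y /not_implyP[Fy hy]]; exists y; split => // _ x Ax.
    by rewrite ltNge; apply/negP => xy; apply: hy; exists x.
  have [y hy] := choice Hy.
  have [|p Cp py] := lim y; first by move=> m; apply: (FC m); have [] := hy m.
  have Ap : A p by apply: memA py; apply: filterS filterT => m _; have [] := hy m.
  have [m [pm nm]] := ultra_ex UU (filterI (py _ eps0) H).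
  by have [_ /(_ nm p Ap)] := hy m; rewrite ltNge (ltW pm).
Qed.

(** Bodies with values exceeding every [m] would have a limit body along [U], and continuity at that
    limit bounds the values for a set of indices in [U]. As [U] contains the cofinite sets, such an
    index can be taken arbitrarily large. *)
Lemma hausdorff_continuous_bounded phi (C : set V) : hausdorff_continuous phi -> compact C ->
  exists2 B : R, 0 <= B & forall L, (L : set V) `<=` C -> `|phi L| <= B.
Proof.
move=> /hausdorff_continuousP cphi cC.
have [[B hB]|H] := pselect (exists B : R, forall L, (L : set V) `<=` C -> `|phi L| <= B).
  by exists (Num.max B 0) => [|L LC]; rewrite le_max ?lexx ?orbT// hB.
have HF m : exists L, (L : set V) `<=` C /\ m%:R < `|phi L|.
  have [//|h] := pselect (exists L, (L : set V) `<=` C /\ m%:R < `|phi L|).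
  exfalso; apply: H; exists m%:R => L LC; rewrite leNgt; apply/negP => Lm.
  by apply: h; exists L.
have [F hF] := choice HF.
have [U [UU eU]] := nat_ultrafilter.
have [|A hA] := @ultra_body_limit U C F UU cC; first by move=> m; have [] := hF m.
have [d d0 hd] := cphi A 1 ltr01.
pose k := Num.bound (`|phi A| + 1).
have [m [Am km]] := ultra_ex UU (filterI (hA d d0) (eU _ (nbhs_infty_ge k))).
have h1 := hd _ Am; have [_ hm] := hF m.
have h2 : `|phi A| + 1 < m%:R.
  apply: (lt_le_trans (archi_boundP _)); first by rewrite addr_ge0.
  by rewrite ler_nat.
have := ler_normD (phi (F m) - phi A) (phi A); rewrite subrK.
move: h1 h2 hm; move: (`|phi (F m) - phi A|) (`|phi A|) (`|phi (F m)|) => a b c; lra.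
Qed.

Definition affine_body (g : 'M[R]_n) (t : V) L : convex_body R n :=
  ConvexBody (affine_image_body g t L).

Lemma affine_close (g g' : 'M[R]_n) (t t' : V) L (rho e : R) :
  (forall x, (L : set V) x -> `|x| <= rho) -> 0 <= rho ->
  n%:R * `|g - g'| * rho + `|t - t'| <= e ->
  forall x, (L : set V) x -> `|(g *m x + t) - (g' *m x + t')| <= e.
Proof.
move=> hL rho0 he x Lx; rewrite opprD addrACA -mulmxBl.
apply: (le_trans (ler_normD _ _)); apply: le_trans he; rewrite lerD2r.
by apply: (le_trans (mulmx_norm_le _ _)); rewrite ler_wpM2l ?hL// mulr_ge0.
Qed.

Definition hit_set M L : set ('M[R]_n * V) :=
  [set z | (M `&` affine_image z.1 z.2 L : set V) !=set0].

Lemma affine_eval_continuous :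
  continuous (fun z : 'M[R]_n * V * V => z.1.1 *m z.2 + z.1.2).
Proof.
apply: continuous_addr; last by move=> z; apply: (cvg_comp fst snd); [exact: cvg_fst|exact: cvg_snd].
apply: continuous_mx => i j; under eq_fun do rewrite mxE.
apply: continuous_sumr => k; apply: continuous_mulr => z.
  apply: (cvg_comp (fun z : 'M[R]_n * V * V => z.1.1) (fun g : 'M[R]_n => g i k)).
    by apply: (cvg_comp fst fst); exact: cvg_fst.
  exact: coord_continuous.
apply: (cvg_comp (fun z : 'M[R]_n * V * V => z.2) (fun x : V => x k j)); first exact: cvg_snd.
exact: coord_continuous.
Qed.

(** Common points of the approximating positions come from points of [L]; by compactness these have
    a limit along [U], whose image is a common point for the limit position. *)
Lemma hit_set_closed M L : closed (hit_set M L).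
Proof.
move=> [g t] clz.
have [U [UU eU]] := nat_ultrafilter.
have H m : exists gtx : 'M[R]_n * V * V, [/\ ball (g, t) (m.+1%:R^-1 : R) gtx.1,
    (L : set V) gtx.2 & (M : set V) (gtx.1.1 *m gtx.2 + gtx.1.2)].
  have m0 : 0 < (m.+1%:R^-1 : R) by rewrite invr_gt0.
  have [gt' [[y [My [x Lx yE]]] hgt]] := clz _ (nbhsx_ballx (g, t) m.+1%:R^-1 m0).
  by exists (gt', x); split => //=; rewrite yE.
have [z hz] := choice H.
have [_ cL _] := body_convex L.
have [|x Lx zx] := @ultra_seq_cvg _ _ U UU _ (fun m => (z m).2) cL.
  by apply: filterS filterT => m _; have [] := hz m.
exists (g *m x + t); split; last by exists x.
apply: body_closed => B xB.
have /nbhs_ballP[e /= e0 He] := @affine_eval_continuous (g, t, x) B xB.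
have [k hk] : exists k, (k.+1%:R^-1 : R) < e.
  by have [k] := @ltr_add_invr R 0 _ e0; rewrite add0r => ?; exists k.
have [m [km xm]] := ultra_ex UU (filterI (eU _ (nbhs_infty_ge k)) (zx _ e0)).
have [hgt Lz Mz] := hz m.
exists ((z m).1.1 *m (z m).2 + (z m).1.2); split=> //.
apply: (He (z m)); split => /=; last by rewrite -ball_normE.
apply: le_ball hgt; apply: le_trans (ltW hk).
by rewrite lef_pV2 ?posrE// ler_nat.
Qed.

(* The segment from a point [y] of [M_e] to a centre [p] of an [e]-ball inside
   [M_e] moves a point of the intersection away from the boundary. *)
Lemma thick_close M (Me : convex_body R n) L (g g' : 'M[R]_n) (t t' : V) (rho e D h : R) :
  (forall x, (L : set V) x -> `|x| <= rho) -> 0 <= rho ->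
  (forall p v, (M : set V) p -> `|v| <= e -> (Me : set V) (p + v)) -> 0 < e ->
  (forall x y, (Me : set V) x -> (Me : set V) y -> `|x - y| <= D) ->
  hit_set M L (g, t) ->
  n%:R * `|g - g'| * rho + `|t - t'| <= h -> 0 <= h <= e ->
  forall y, (Me `&` affine_image g t L) y ->
    exists2 y', (Me `&` affine_image g' t' L) y' & `|y - y'| <= h * (1 + D / e).
Proof.
move=> hL rho0 hMe e0 hD [p [/= Mp [x0 Lx0 pE]]] hgt /andP[h0 he] y [My [x Lx yE]].
rewrite -pE in Mp; rewrite -yE in My *.
have [_ _ /convex_setP vL] := body_convex L.
have [_ _ /convex_setP vMe] := body_convex Me.
have Mp0 : (M : set V) (g *m x0 + t) by [].
have Mep : (Me : set V) (g *m x0 + t).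
  by rewrite -[X in _ X]addr0; apply: hMe => //; rewrite normr0 ltW.
(* The smallest weight for which a displacement of length [h] is [s] times a displacement of length
   [e]. Moving from [x] to [xs] costs at most [s D], and changing [(g, t)] to [(g', t')] at most
   [h]. *)
pose s := h / e.
have s0 : 0 <= s by rewrite divr_ge0// ltW.
have s1 : s <= 1 by rewrite ler_pdivrMr// mul1r.
have s01 : 0 <= s <= 1 by rewrite s0.
pose xs := s *: x0 + (1 - s) *: x.
have Lxs : (L : set V) xs by exact: vL.
have h1 := affine_close hL rho0 hgt Lxs.
have lin : g *m xs + t = s *: (g *m x0 + t) + (1 - s) *: (g *m x + t).
  rewrite /xs mulmxDr -!scalemxAr !scalerDr addrACA -scalerDl (addrC s) subrK scale1r//.
exists (g' *m xs + t').
  split; last by exists xs.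
  have [s_0|sn0] := eqVneq s 0.
    have hz : h = 0 by move: s_0; rewrite /s => /eqP; rewrite mulf_eq0 invr_eq0 (gt_eqF e0) orbF => /eqP.
    move: h1; rewrite hz normr_le0 subr_eq0 => /eqP <-.
    by rewrite lin s_0 scale0r add0r subr0 scale1r.
  have sp : 0 < s by rewrite lt_neqAle eq_sym sn0.
  (* The displacement is charged to the endpoint [p], where it is magnified by [1 / s] to length at
     most [e] and so stays in [Me]. The new point is then a convex combination of two points of
     [Me]. *)
  have -> : g' *m xs + t' = s *: ((g *m x0 + t) + s^-1 *: ((g' *m xs + t') - (g *m xs + t))) + (1 - s) *: (g *m x + t).
    rewrite scalerDr scalerA divff// scale1r addrAC -lin addrC subrK//.
  apply: vMe => //; apply: hMe => //.
  rewrite normrZ ger0_norm ?invr_ge0// ler_pdivrMl// distrC.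
  by rewrite /s divfK// gt_eqF.
rewrite -(subrKA (g *m xs + t)).
apply: (le_trans (ler_normD _ _)); rewrite mulrDr mulr1 addrC; apply: lerD => //.
have -> : g *m x + t - (g *m xs + t) = s *: ((g *m x + t) - (g *m x0 + t)).
  rewrite lin scalerBl scale1r scalerBr; set a := _ + t; set b := _ + t.
  by rewrite opprD opprB addrCA (addrC (s *: a)) addNKr addrC.
rewrite normrZ ger0_norm// (mulrCA h) (mulrC D); apply: ler_wpM2l => //; exact: hD.
Qed.

Lemma thick_body M (e : R) : 0 < e ->
  exists Me : convex_body R n, forall x, (Me : set V) x <-> exists2 p, (M : set V) p & `|x - p| <= e.
Proof.
move=> e0; have [[p Mp] cM /convex_setP vM] := body_convex M.
pose A : set V := (fun z : V * V => z.1 + z.2) @` ((M : set V) `*` [set x : V | `|x| <= e]).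
have AE x : A x <-> exists2 p, (M : set V) p & `|x - p| <= e.
  split=> [[[q v] /= [Mq ve] <-]|[q Mq xq]].
    by exists q => //; rewrite addrC addKr.
  by exists (q, x - q) => //=; rewrite addrC subrK.
have bA : is_convex_body A.
  split.
  - by exists p; apply/AE; exists p => //; rewrite subrr normr0 ltW.
  - apply: continuous_compact.
      apply: continuous_subspaceT; apply: continuous_addr => z; [exact: cvg_fst|exact: cvg_snd].
    by apply: compact_setX => //; exact: compact_ball_cV.
  - apply/convex_setP => x y s /andP[s0 s1] /AE[q Mq xq] /AE[r Mr yr]; apply/AE.
    exists (s *: q + (1 - s) *: r); first by apply: vM => //; exact/andP.
    rewrite opprD addrACA -!scalerBr; apply: (le_trans (ler_normD _ _)).
    rewrite !normrZ !ger0_norm ?subr_ge0//.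
    have -> : e = s * e + (1 - s) * e by rewrite -mulrDl addrC subrK mul1r.
    by rewrite lerD// ler_wpM2l ?subr_ge0.
by exists (ConvexBody bA).
Qed.

End convex_bodies.

Lemma relatively_open_preimage (R : realType) (T : normedModType R) (S : set T) (f : T -> R) (B : set R) :
  (forall z, S z -> forall eps : R, 0 < eps -> exists2 d : R, 0 < d &
    forall z', S z' -> ball z d z' -> `|f z' - f z| < eps) ->
  open B -> exists2 W, open W & S `&` f @^-1` B = S `&` W.
Proof.
move=> cf oB.
pose I := [set p : T * R | S p.1 /\ S `&` ball p.1 p.2 `<=` f @^-1` B].
exists (\bigcup_(p in I) ball p.1 p.2).
  by apply: bigcup_open => p _; exact: ball_open.
apply/seteqP; split=> [z [Sz Bz]|z [Sz [p [_ h] pz]]]; split => //; last exact: h.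
have : nbhs (f z) B by exact: open_nbhs_nbhs.
move=> /nbhs_ballP[e /= e0 eB].
have [d d0 hd] := cf z Sz e e0.
exists (z, d) => /=; last exact: ballxx.
split => // z' [Sz' zz']; apply: eB; rewrite /ball/= distrC; exact: hd.
Qed.

Lemma eps_delta_continuous (R : realType) (T : normedModType R) (f : T -> R) :
  (forall z (eps : R), 0 < eps -> exists2 d : R, 0 < d &
    forall z', ball z d z' -> `|f z' - f z| < eps) -> continuous f.
Proof.
move=> h z; apply/cvgrPdist_lt => eps eps0; have [d d0 hd] := h z eps eps0.
by apply/nbhs_ballP; exists d => // z' zz'; rewrite distrC; exact: hd.
Qed.

(** * Measurability of valuations of intersections and of linear images *)

Section intersection_measurable.
Context {R : realType} {n : nat}.
Local Notation V := 'cV[R]_n.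
Implicit Types (L M : convex_body R n) (phi : convex_body R n -> R).

Lemma measurable_hit_set M L :
  measurable (hit_set M L : set (borel 'M[R]_n * borel V)%type).
Proof.
rewrite -(setCK (hit_set M L)); apply: measurableC; apply: measurable_open_mx2.
exact: closed_openC (@hit_set_closed _ _ M L).
Qed.

(** The positions range over those that hit [M] itself, so the thickened intersection always
    contains a point with margin [e]. [thick_close] gives one half of the closeness; the other
    follows by exchanging the two positions, which is why both have to hit [M]. *)
Lemma thick_intersection_continuous phi M (Me : convex_body R n) L (e : R) :
  hausdorff_continuous phi -> 0 < e ->
  (forall p v, (M : set V) p -> `|v| <= e -> (Me : set V) (p + v)) ->
  forall z, hit_set M L z -> forall eps : R, 0 < eps -> exists2 d : R, 0 < d &
    forall z', hit_set M L z' -> ball z d z' ->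
    `|extend0 phi (Me `&` affine_image z'.1 z'.2 L) -
      extend0 phi (Me `&` affine_image z.1 z.2 L)| < eps.
Proof.
move=> /hausdorff_continuousP cphi e0 hMe z Sz eps eps0.
have bodyS z' : hit_set M L z' -> is_convex_body (Me `&` affine_image z'.1 z'.2 L).
  move=> [y [My Ly]]; apply: (@body_setI_body _ _ Me (affine_body z'.1 z'.2 L)).
  by exists y; split => //; rewrite -[y]addr0; apply: hMe => //; rewrite normr0 ltW.
have [d d0 hd] := cphi (ConvexBody (bodyS z Sz)) eps eps0.
have [rho rho0 hrho] := body_bounded L.
have [rM rM0 hrM] := body_bounded Me.
pose D := rM + rM.
have hD x y : (Me : set V) x -> (Me : set V) y -> `|x - y| <= D.
  by move=> Mx My; apply: (le_trans (ler_normB _ _)); rewrite lerD// hrM.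
have D0 : 0 < D by exact: addr_gt0.
pose c := 1 + D / e.
have c0 : 0 < c by rewrite addr_gt0// divr_gt0.
(* Below [e], as [thick_close] requires, and with [h * (1 + D / e) <= d]. The radius [h / b] then
   keeps the displacement of the points of [L] within [h]. *)
pose h := Num.min e (d / c).
have h0 : 0 < h by rewrite lt_min e0 divr_gt0.
pose b := n%:R * rho + 1.
have b0 : 0 < b by rewrite ltr_wpDl// mulr_ge0// ltW.
exists (h / b); first by rewrite divr_gt0.
move=> z' Sz' [/= zz1 zz2].
rewrite (extend0E _ (bodyS z Sz)) (extend0E _ (bodyS z' Sz')); apply: hd => /=.
have hle : h * (1 + D / e) <= d.
  by rewrite -ler_pdivlMr// ge_min lexx orbT.
have dist (g g' : 'M[R]_n) (t t' : V) : `|g - g'| < h / b -> `|t - t'| < h / b ->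
    n%:R * `|g - g'| * rho + `|t - t'| <= h.
  move=> gg tt; rewrite mulrAC; apply: (@le_trans _ _ (n%:R * rho * (h / b) + h / b)).
    apply: lerD; last exact: ltW.
    by apply: ler_wpM2l; [rewrite mulr_ge0// ltW|exact: ltW].
  rewrite -[X in _ + X]mul1r -mulrDl -/b mulrCA divff ?mulr1// gt_eqF//.
have z1 : `|z.1 - z'.1| < h / b by move: zz1; rewrite -ball_normE.
have z2 : `|z.2 - z'.2| < h / b by move: zz2; rewrite -ball_normE.
have hh : 0 <= h <= e by rewrite ltW//= ge_min lexx.
have Sz_ : hit_set M L (z.1, z.2) by case: z Sz {z1 z2 zz1 zz2}.
have Sz'_ : hit_set M L (z'.1, z'.2) by case: z' Sz' {z1 z2 zz1 zz2}.
split=> [x Ax|y Ay].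
- have [y yA xy] := thick_close hrho (ltW rho0) hMe e0 hD Sz_ (dist _ _ _ _ z1 z2) hh Ax.
  by exists y => //; apply: le_trans hle.
- rewrite distrC in z1; rewrite distrC in z2.
  have [x xA yx] := thick_close hrho (ltW rho0) hMe e0 hD Sz'_ (dist _ _ _ _ z1 z2) hh Ay.
  by exists x => //; rewrite distrC; apply: le_trans hle.
Qed.

(** Decreasing compact sets converge to their intersection in the Hausdorff sense: points of the
    thickened intersections that stay away from the limit set would have a limit lying in both [M]
    and [g L + t]. *)
Lemma thick_intersection_cvg phi M (Me : nat -> convex_body R n) L (g : 'M[R]_n) (t : V) :
  hausdorff_continuous phi ->
  (forall m x, (Me m : set V) x <-> exists2 p, (M : set V) p & `|x - p| <= m.+1%:R^-1) ->
  hit_set M L (g, t) ->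
  extend0 phi (Me m `&` affine_image g t L) @[m --> \oo] -->
  extend0 phi (M `&` affine_image g t L).
Proof.
move=> /hausdorff_continuousP cphi hMe Sz.
have MMe m x : (M : set V) x -> (Me m : set V) x.
  by move=> Mx; apply/hMe; exists x => //; rewrite subrr normr0 invr_ge0.
have bM : is_convex_body (M `&` affine_image g t L).
  exact: (@body_setI_body _ _ M (affine_body g t L)).
have bMe m : is_convex_body (Me m `&` affine_image g t L).
  apply: (@body_setI_body _ _ (Me m) (affine_body g t L)).
  by have [y [My Ly]] := Sz; exists y; split => //; exact: MMe.
rewrite (extend0E _ bM); under eq_fun do rewrite (extend0E _ (bMe _)).
apply/cvgrPdist_lt => eps eps0.
have [d d0 hd] := cphi (ConvexBody bM) eps eps0.
suff : \forall m \near \oo, close_sets d (M `&` affine_image g t L : set V) (Me m `&` affine_image g t L).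
  by apply: filterS => m hm; rewrite distrC; exact: hd.
have [//|H] := pselect (\forall m \near \oo, close_sets d (M `&` affine_image g t L : set V) (Me m `&` affine_image g t L)).
exfalso.
(* Failure of an eventual property gives a bad index only somewhere beyond each [m]; hence the [k],
   and [k >= m] makes the thickening of radius [1 / (k + 1)] at least as thin as the one of index
   [m]. *)
have bad m : exists y, (affine_image g t L) y /\ exists k, [/\ (m <= k)%N, (Me k : set V) y &
    forall x, (M `&` affine_image g t L : set V) x -> d < `|x - y|].
  have [//|h] := pselect (exists y, (affine_image g t L) y /\ exists k, [/\ (m <= k)%N, (Me k : set V) y &
    forall x, (M `&` affine_image g t L : set V) x -> d < `|x - y|]).
  exfalso; apply: H; exists m => // k /= mk; split=> [x [Mx Lx]|y [My Ly]].
    by exists x; [split => //; exact: MMe|rewrite subrr normr0 ltW].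
  have [//|h'] := pselect (exists2 x, (M `&` affine_image g t L : set V) x & `|x - y| <= d).
  exfalso; apply: h; exists y; split => //; exists k; split => // x Mx.
  by rewrite ltNge; apply/negP => xy; apply: h'; exists x.
have [y hy] := choice bad.
have [U [UU eU]] := nat_ultrafilter.
have [_ cL _] := affine_image_body g t L.
have [|p Lp py] := @ultra_seq_cvg _ _ U UU _ y cL.
  by apply: filterS filterT => m _; have [] := hy m.
have Mp : (M : set V) p.
  apply: body_closed => B /nbhs_ballP[e /= e0 peB].
  have e2 : 0 < e / 2 by rewrite divr_gt0.
  have [k hk] : exists k, (k.+1%:R^-1 : R) < e / 2.
    by have [k] := @ltr_add_invr R 0 _ e2; rewrite add0r => ?; exists k.
  have [m [km pm]] := ultra_ex UU (filterI (eU _ (nbhs_infty_ge k)) (py _ e2)).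
  have [_ [j [mj /hMe[q Mq yq] _]]] := hy m.
  exists q; split => //; apply: peB; rewrite -ball_normE /=.
  rewrite -(subrKA (y m)) [e]splitr; apply: (le_lt_trans (ler_normD _ _)).
  apply: ltrD => //; apply: (le_lt_trans yq); apply: le_lt_trans hk.
  by rewrite lef_pV2 ?posrE// ler_nat ltnS (leq_trans km).
have [m pm] := ultra_ex UU (py _ d0).
have [_ [k [_ _ /(_ p)]]] := hy m.
by move=> /(_ (conj Mp Lp)); rewrite ltNge ltW.
Qed.

(* On the closed set where [M] meets [g L + t], the function is the limit, for
   [m] going to infinity, of the same functions for the closed
   [1/(m+1)]-neighbourhoods of [M], and these are continuous on that set. *)
Lemma measurable_intersection phi M L : hausdorff_continuous phi ->
  measurable_fun setT (fun z : borel 'M[R]_n * borel V =>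
    extend0 phi (M `&` affine_image z.1 z.2 L)).
Proof.
move=> cphi.
have mS := measurable_hit_set M L.
have mSC := measurableC mS.
rewrite -(setUv (hit_set M L)); apply/measurable_funU => //; split; last first.
  have : measurable_fun (~` hit_set M L : set (borel 'M[R]_n * borel V)) (cst (0 : R)) by exact: measurable_cst.
  apply: eq_measurable_fun => z /set_mem Sz; rewrite /= extend0_empty//.
  by apply/seteqP; split=> // y My; apply: Sz; exists y.
have pickMe m : exists Me : convex_body R n, forall x, (Me : set V) x <->
    exists2 p, (M : set V) p & `|x - p| <= m.+1%:R^-1.
  by apply: thick_body; rewrite invr_gt0.
have [Me hMe] := choice pickMe.
apply: (measurable_fun_cvg (h := fun m (z : borel 'M[R]_n * borel V) => extend0 phi (Me m `&` affine_image z.1 z.2 L))).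
  move=> m; apply: borel_measurable_funR => // B oB.
  have me0 : 0 < (m.+1%:R^-1 : R) by rewrite invr_gt0.
  have hMem (p v : V) : (M : set V) p -> `|v| <= m.+1%:R^-1 -> (Me m : set V) (p + v).
    by move=> Mp ve; apply/hMe; exists p => //; rewrite addrC addKr.
  have ct := thick_intersection_continuous cphi me0 hMem (L := L).
  have [W oW ->] := relatively_open_preimage ct oB.
  by apply: measurableI => //; exact: measurable_open_mx2.
by move=> [g t] Sz; exact: thick_intersection_cvg.
Qed.

(** Unlike the intersection, the image [g L] depends continuously on [g], singular matrices
    included. *)
Lemma measurable_linear_image phi L : hausdorff_continuous phi ->
  measurable_fun setT (fun g : borel 'M[R]_n => extend0 phi (affine_image g 0 L)).
Proof.
move=> /hausdorff_continuousP cphi; apply: continuous_borel_measurableR.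
apply: (@eps_delta_continuous R 'M[R]_n) => g eps eps0.
rewrite (extend0E _ (affine_image_body g 0 L)).
have [d d0 hd] := cphi (affine_body g 0 L) eps eps0.
have [rho rho0 hrho] := body_bounded L.
pose b := n%:R * rho + 1.
have b0 : 0 < b by rewrite ltr_wpDl// mulr_ge0// ltW.
have db : 0 < d / b by rewrite divr_gt0.
exists (d / b) => // g'; rewrite -ball_normE /= => gg'.
rewrite (extend0E _ (affine_image_body g' 0 L)); apply: hd => /=.
have hh : n%:R * `|g - g'| * rho + `|(0 : V) - 0| <= d.
  rewrite subrr normr0 addr0 mulrAC; apply: (@le_trans _ _ (b * (d / b))).
    by rewrite ler_pM ?mulr_ge0// ?ltW// /b ltrDl.
  by rewrite mulrCA divff ?mulr1// gt_eqF.
have H := affine_close (t := 0) (t' := 0) hrho (ltW rho0) hh.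
split=> [_ [x Lx <-]|_ [x Lx <-]].
  by exists (g' *m x + 0); [exists x|exact: H].
by exists (g *m x + 0); [exists x|exact: H].
Qed.

End intersection_measurable.

(** * The Cartan decomposition *)

Section matrix_exponential.
Context {R : realType} {n : nat}.
Implicit Types X P Q : 'M[R]_n.

(** The maximum norm is submultiplicative only up to a dimensional factor, which accounts for the
    constant in all later exponential bounds. *)
Lemma exprmx_norm_le X k : `|X ^+ k| <= (n.+1%:R * `|X|) ^+ k.
Proof.
elim: k => [|k IH].
  rewrite !expr0; apply: mx_norm_le => // i j; rewrite mxE.
  by case: (i == j); rewrite ?normr1 ?normr0.
rewrite !exprS; apply: (le_trans (mulmx_norm_le _ _)).
rewrite ler_pM ?mulr_ge0// ler_wpM2r// ler_nat//.
Qed.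

Let u X i j k : R := k`!%:R^-1 * (X ^+ k) i j.

Let u_le X i j k : `|u X i j k| <= exp_coeff (n.+1%:R * `|X|) k.
Proof.
rewrite /u normrM ger0_norm// /exp_coeff /= mulrC ler_wpM2r//.
by apply: (le_trans (ler_mx_norm _ _ _)); exact: exprmx_norm_le.
Qed.

Let u_ncvg X i j : cvgn [normed series (u X i j)].
Proof.
apply: (series_le_cvg _ _ (u_le X i j)) => [//|k|]; last exact: is_cvg_series_exp_coeff.
by rewrite exp_coeff_ge0// mulr_ge0.
Qed.

Let u_cvg X i j : cvgn (series (u X i j)).
Proof. by apply: (@normed_cvg _ R^o); exact: u_ncvg. Qed.

(** Each entry is an absolutely convergent series dominated by a real exponential series. Since
    [expmx] is defined through [limn], this convergence is what gives its definition content. *)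
Lemma expmx_cvg_coord X :
  series (fun k => (k`!%:R)^-1 *: X ^+ k) @ \oo --> \matrix_(i, j) limn (series (u X i j)).
Proof.
apply: cvg_mx => i j; rewrite mxE.
rewrite (_ : (fun k => _) = series (u X i j)); first exact: u_cvg.
by apply/funext => k; rewrite /series/= summxE; apply: eq_bigr => l _; rewrite mxE.
Qed.

Lemma expmx_cvg X : series (fun k => (k`!%:R)^-1 *: X ^+ k) @ \oo --> expmx X.
Proof.
have h := @expmx_cvg_coord X.
by rewrite /expmx (cvg_lim (@norm_hausdorff _ _) h).
Qed.

Lemma expmx_norm_le X : `|expmx X| <= expR (n.+1%:R * `|X|).
Proof.
have -> : expmx X = \matrix_(i, j) limn (series (u X i j)).
  exact: (cvg_lim (@norm_hausdorff _ _) (@expmx_cvg_coord X)).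
apply: mx_norm_le => [|i j]; first exact: expR_ge0.
have a0 : 0 <= n.+1%:R * `|X| by rewrite mulr_ge0.
have bnd k : `|series (u X i j) k| <= expR (n.+1%:R * `|X|).
  apply: (le_trans (ler_norm_sum _ _ _)).
  apply: (@le_trans _ _ (series (exp_coeff (n.+1%:R * `|X|)) k)).
    by apply: ler_sum => l _; exact: u_le.
  apply: nondecreasing_cvgn_le; last exact: is_cvg_series_exp_coeff.
  by apply: nondecreasing_series => l _ _; exact: exp_coeff_ge0.
rewrite mxE ler_norml; apply/andP; split.
  by apply: limr_ge; [exact: u_cvg|apply: nearW => k; have := bnd k; rewrite ler_norml => /andP[]].
by apply: limr_le; [exact: u_cvg|apply: nearW => k; have := bnd k; rewrite ler_norml => /andP[]].
Qed.

Lemma mulmxr_continuous m p q (Q : 'M[R]_(p, q)) :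
  continuous (fun x : 'M[R]_(m, p) => x *m Q).
Proof.
apply: continuous_mx => i j; under eq_fun do rewrite mxE.
apply: continuous_sumr => k; apply: continuous_mulr; last exact: cst_continuous.
exact: coord_continuous.
Qed.

Lemma conjmx_continuous P Q : continuous (fun x : 'M[R]_n => P *m x *m Q).
Proof.
move=> x; apply: (cvg_comp (fun x : 'M[R]_n => P *m x) (fun x : 'M[R]_n => x *m Q)).
  exact: mulmx_continuous.
exact: mulmxr_continuous.
Qed.

Lemma expmx_conj P Q X : Q *m P = 1%:M -> expmx (P *m X *m Q) = P *m expmx X *m Q.
Proof.
move=> QP; have PQ := mulmx1C QP.
have pow k : (P *m X *m Q) ^+ k = P *m X ^+ k *m Q.
  elim: k => [|k IH]; first by rewrite !expr0 mulmx1 PQ.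
  by rewrite !exprS IH -!mulmxE !mulmxA -(mulmxA _ Q P) QP mulmx1.
rewrite {1}/expmx; apply: (cvg_lim (@norm_hausdorff _ _)).
rewrite (_ : series _ = (fun x => P *m x *m Q) \o series (fun k => (k`!%:R)^-1 *: X ^+ k)).
  apply: (continuous_cvg _ (@conjmx_continuous P Q (expmx X))); exact: expmx_cvg.
apply/funext => k; rewrite /series/= mulmx_sumr mulmx_suml; apply: eq_bigr => l _.
by rewrite pow -scalemxAr -scalemxAl.
Qed.

End matrix_exponential.

Lemma is_derive_linear_continuous (R : realType) (V W W' : normedModType R)
    (A : {linear W -> W'}) (f : V -> W) (x v : V) (df : W) :
  continuous A -> is_derive x v f df -> is_derive x v (A \o f) (A df).
Proof.
move=> cA [der dE].
have : (fun h => h^-1 *: (((A \o f) \o shift x) (h *: v) - (A \o f) x)) @ 0^' --> A df.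
  rewrite (_ : (fun h => _) = A \o (fun h => h^-1 *: ((f \o shift x) (h *: v) - f x))).
    by apply: (cvg_comp _ A _ (cA df)); rewrite -dE; exact: der.
  by apply/funext => h; rewrite /= -(raddfB A) [RHS]linearZ.
move=> h; apply: DeriveDef; first by apply/cvg_ex; exists (A df).
exact: (cvg_lim (@norm_hausdorff _ _) h).
Qed.

Lemma continuous_oppr (R : realType) (T : topologicalType) (V : normedModType R) (f : T -> V) :
  continuous f -> continuous (fun x => - f x).
Proof. by move=> cf x; apply: cvgN; exact: cf. Qed.

(** Smoothness provides only local extensions of [f]; each is continuous by the case [k = 0] of
    [is_Ck], and the open sets they yield are glued by a union. *)
Lemma smooth_on_relatively_open (R : realType) (E F : normedModType R) (S : set E)
    (f : E -> F) (B : set F) :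
  smooth_on S f -> open B -> exists2 W, open W & S `&` f @^-1` B = S `&` W.
Proof.
move=> sf oB.
exists (\bigcup_(A in [set A | open A /\ S `&` A `<=` f @^-1` B]) A).
  by apply: bigcup_open => A [].
apply/seteqP; split=> [z [Sz Bz]|z [Sz [A [_ h] Az]]]; split => //; last exact: h.
have [U [g [oU Uz Ck gf]]] := sf z Sz.
have cg : {for z, continuous g} by exact: (Ck 0%N).
have : nbhs z (U `&` g @^-1` B).
  apply: filterI; first exact: open_nbhs_nbhs.
  by apply: cg; apply: open_nbhs_nbhs; split => //=; rewrite gf.
rewrite nbhsE => -[A [oA Az] AUB]; exists A => //; split => // y [Sy /AUB[Uy gBy]].
by rewrite /preimage/= -gf.
Qed.

Section cartan.
Context {R : realType} {n : nat} (G : set 'M[R]_n) (g0 : {vspace 'M[R]_n}).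
Context (Theta : 'M[R]_n -> 'M[R]_n) (theta : 'End('M[R]_n)).
Hypotheses (hG : closed_linear_group G) (hg0 : is_lie_algebra G g0)
  (hcd : cartan_decomposition G g0 Theta theta).
Let K := fixed_subgroup G Theta.
Let p0 := noncompact_part g0 theta.
Hypotheses (hKc : compact K) (hKO : forall k, K k -> k^T *m k = 1%:M).

Lemma fixed_subgroup1 : K 1%:M.
Proof.
have [_ hM _ _] := cd_auto hcd; have G1 := clg_1 hG.
have U1 : Theta 1%:M \in unitmx by apply: (clg_unit hG); apply: ila_stable (cd_auto hcd) _ G1.
split => //; have := hM _ _ G1 G1; rewrite mulmx1 => /(congr1 (mulmx (invmx (Theta 1%:M)))).
by rewrite mulmxA mulVmx// mul1mx => <-.
Qed.

Lemma fixed_subgroup_tr k : K k -> K k^T.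
Proof.
move=> Kk; have kk := hKO Kk; have [Gk Tk] := Kk.
have kT : k^T = invmx k by rewrite -[LHS]mulmx1 -(mulmxV (clg_unit hG Gk)) mulmxA kk mul1mx.
have GkT : G k^T by rewrite kT; exact: clg_inv.
split => //; have [_ hM _ _] := cd_auto hcd.
have := hM _ _ GkT Gk; rewrite Tk kk.
have [_ ->] := fixed_subgroup1.
move=> /(congr1 (fun x => x *m invmx k)); rewrite mul1mx -mulmxA mulmxV ?(clg_unit hG)// mulmx1 => <-.
by rewrite -kT.
Qed.

Lemma noncompact_partP X : X \in p0 <-> X \in g0 /\ theta X = - X.
Proof.
rewrite /p0 /noncompact_part memv_cap; split.
  move=> /andP[Xg]; rewrite memv_ker add_lfunE opp_lfunE scale_lfunE id_lfunE scaleN1r opprK addr_eq0.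
  by move/eqP.
by move=> [-> h]; rewrite memv_ker add_lfunE opp_lfunE scale_lfunE id_lfunE scaleN1r opprK h addNr eqxx.
Qed.

Lemma expmx_group X : X \in p0 -> G (expmx X).
Proof. by move=> /noncompact_partP[/hg0 /(_ 1)]; rewrite scale1r. Qed.

(** Since [Theta] fixes [k], it commutes with conjugation by [k] along the curve [e^(tX)].
    Differentiating at 0 gives [theta (k X k^T) = k (theta X) k^T = - k X k^T]. *)
Lemma noncompact_part_conj k X : K k -> X \in p0 -> k *m X *m k^T \in p0.
Proof.
move=> Kk /noncompact_partP[Xg tX].
have [Gk Tk] := Kk; have [GkT TkT] := fixed_subgroup_tr Kk; have kk := hKO Kk.
have expE (t : R) : expmx (t *: (k *m X *m k^T)) = k *m expmx (t *: X) *m k^T.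
  by rewrite -expmx_conj// scalemxAl scalemxAr.
have GX t : G (expmx (t *: X)) by exact: (hg0 X).1.
have Yg : k *m X *m k^T \in g0.
  by apply/hg0 => t; rewrite expE; apply: clg_mul => //; exact: clg_mul.
apply/noncompact_partP; split => //.
have [_ hM _ _] := cd_auto hcd.
pose A := mulmxr k^T \o mulmx k : 'M[R]_n -> 'M[R]_n.
have d1 := cd_diff hcd Xg; have d2 := cd_diff hcd Yg.
have d3 : is_derive (0 : R) 1 (A \o (fun t : R => Theta (expmx (t *: X)))) (A (theta X)).
  by apply: is_derive_linear_continuous; exact: conjmx_continuous.
have fE : (fun t : R => Theta (expmx (t *: (k *m X *m k^T)))) = A \o (fun t : R => Theta (expmx (t *: X))).
  apply/funext => t /=; rewrite expE hM// ?hM// ?Tk ?TkT//; exact: clg_mul.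
rewrite fE in d2; have [_ <-] := d2; have [_ ->] := d3.
by rewrite /A /= tX mulmxN mulNmx.
Qed.

Lemma measurable_fixed_subgroup : measurable (K : set (borel 'M[R]_n)).
Proof. by apply: measurable_closed_borel; apply: compact_closed hKc; exact: norm_hausdorff. Qed.

Context (e : (\dim p0).-tuple 'M[R]_n) (he : orthonormal_basis_of p0 e).

Lemma noncompact_part_span X : X \in p0 <->
  X = span_map e (\col_i frob_inner (tnth e i) X).
Proof.
have [be oe] := he; split=> [Xp|->].
  have := coord_basis be Xp.
  rewrite /span_map => XE; rewrite {1}XE; apply: eq_bigr => i _.
  rewrite mxE (tnth_nth 0); congr (_ *: _).
  rewrite [in RHS]XE frob_inner_sumr (bigD1 i)//= -!tnth_nth oe eqxx mulr1 big1 ?addr0// => j ji.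
  by rewrite -!tnth_nth oe eq_sym (negbTE ji) mulr0.
rewrite /span_map; apply: memv_suml => i _; apply: memvZ.
exact: (basis_mem be (mem_tnth i e)).
Qed.

(** The subspace is the zero set of the difference between a matrix and its orthogonal projection, a
    continuous map. *)
Lemma noncompact_part_closed : closed [set X | X \in p0].
Proof.
pose f (X : 'M[R]_n) := X - span_map e (\col_i frob_inner (tnth e i) X).
rewrite (_ : [set X | X \in p0] = f @^-1` [set 0]).
  apply: (@preimage_closed _ _ f [set 0]); last first.
    by apply: compact_closed; [exact: norm_hausdorff|exact: compact_set1].
  suff cf : continuous f by move=> X _; exact: cf.
  apply: continuous_addr; first by move=> X; exact: cvg_id.
  have cc : continuous (fun X : 'M[R]_n => \col_i frob_inner (tnth e i) X : 'cV[R]_(\dim p0)).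
    apply: continuous_mx => i j; under eq_fun do rewrite mxE frob_innerE.
    apply: continuous_sumr => a; apply: continuous_sumr => b.
    by apply: continuous_mulr; [exact: cst_continuous|exact: coord_continuous].
  apply: continuous_oppr => X.
  exact: (cvg_comp _ (span_map e) (cc X) (@continuous_span_map _ _ _ e _)).
apply/seteqP; split=> X /=.
  by rewrite /f => /noncompact_part_span <-; rewrite subrr.
by move=> /eqP; rewrite subr_eq0 => /eqP h; apply/noncompact_part_span.
Qed.

Lemma frob_inner_conj k X Y : K k ->
  frob_inner (k *m X *m k^T) (k *m Y *m k^T) = frob_inner X Y.
Proof.
move=> Kk; have kk := hKO Kk; have kk' := mulmx1C kk.
rewrite /frob_inner !trmx_mul trmxK mxtrace_mulC.
rewrite -!mulmxA (mulmxA k^T k) kk mul1mx !mulmxA mxtrace_mulC !mulmxA kk mul1mx.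
rewrite mxtrace_mulC //.
Qed.

(** Conjugation by [k] preserves the Frobenius inner product and the subspace, so its matrix in an
    orthonormal basis is orthogonal. *)
Lemma noncompact_part_conj_orthogonal k : K k ->
  exists2 Q : 'M[R]_(\dim p0), Q^T *m Q = 1%:M &
    forall x, k *m span_map e x *m k^T = span_map e (Q *m x).
Proof.
move=> Kk; have [be oe] := he.
have ep i : tnth e i \in p0 by exact: (basis_mem be (mem_tnth i e)).
pose Q : 'M[R]_(\dim p0) := \matrix_(i, j) frob_inner (tnth e i) (k *m tnth e j *m k^T).
have adE j : k *m tnth e j *m k^T = \sum_i Q i j *: tnth e i.
  have /noncompact_part_span -> := noncompact_part_conj Kk (ep j).
  by apply: eq_bigr => i _; rewrite !mxE.
exists Q.
  apply/matrixP => i j; rewrite !mxE -(oe i j) -(frob_inner_conj _ _ Kk) adE frob_inner_suml.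
  by apply: eq_bigr => l _; rewrite !mxE.
move=> x; rewrite /span_map mulmx_sumr mulmx_suml.
under eq_bigr do rewrite -scalemxAr -scalemxAl adE scaler_sumr.
rewrite exchange_big/=; apply: eq_bigr => i _; rewrite mxE scaler_suml.
by apply: eq_bigr => j _; rewrite scalerA mulrC.
Qed.

Lemma measurable_noncompact_part : measurable ([set X | X \in p0] : set (borel 'M[R]_n)).
Proof. by apply: measurable_closed_borel; exact: noncompact_part_closed. Qed.

(** Read off from the smoothness of the Cartan diffeomorphism, which makes preimages of open sets
    relatively open in a measurable set. *)
Lemma measurable_cartan :
  measurable_fun ((K : set (borel 'M[R]_n)) `*` ([set X | X \in p0] : set (borel 'M[R]_n)))
    (fun kX : borel 'M[R]_n * borel 'M[R]_n => kX.1 *m expmx kX.2 : borel 'M[R]_n).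
Proof.
have mKp : measurable ((K : set (borel 'M[R]_n)) `*` ([set X | X \in p0] : set (borel 'M[R]_n))).
  by apply: measurableX; [exact: measurable_fixed_subgroup|exact: measurable_noncompact_part].
apply: borel_measurable_fun => // B oB.
have [sf _ _] := cd_diffeo hcd.
have [W oW E] := smooth_on_relatively_open sf oB.
rewrite [X in measurable X]E; apply: measurableI => //.
exact: measurable_open_mx2.
Qed.

Lemma measurable_expmx_part :
  measurable_fun ([set X | X \in p0] : set (borel 'M[R]_n)) (expmx : borel 'M[R]_n -> borel 'M[R]_n).
Proof.
have mp := measurable_noncompact_part.
apply: (eq_measurable_fun ((fun kX : borel 'M[R]_n * borel 'M[R]_n => kX.1 *m expmx kX.2 : borel 'M[R]_n) \o
  (fun X : borel 'M[R]_n => (1%:M, X)))); first by move=> X _ /=; rewrite mul1mx.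
apply: (measurable_comp (F := (K : set (borel 'M[R]_n)) `*` ([set X | X \in p0] : set (borel 'M[R]_n)))).
- by apply: measurableX; [exact: measurable_fixed_subgroup|].
- by move=> _ [X Xp <-]; split => //; exact: fixed_subgroup1.
- exact: measurable_cartan.
- by apply: measurable_funTS; apply: measurable_fun_pair.
Qed.

End cartan.

(** * Averages of valuations *)

Section affine_images.
Context {R : realType} {n : nat}.
Local Notation V := 'cV[R]_n.
Implicit Types (L M : convex_body R n) (phi : convex_body R n -> R).

Lemma affine_image_comp (g g' : 'M[R]_n) (t t' : V) (A : set V) :
  affine_image g t (affine_image g' t' A) = affine_image (g *m g') (g *m t' + t) A.
Proof.
rewrite /affine_image image_comp; congr (_ @` A); apply/funext => x /=.
by rewrite mulmxDr mulmxA addrA.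
Qed.

Lemma affine_imageU (g : 'M[R]_n) (t : V) (A B : set V) :
  affine_image g t (A `|` B) = affine_image g t A `|` affine_image g t B.
Proof. exact: image_setU. Qed.

Lemma affine_imageI (g : 'M[R]_n) (t : V) (A B : set V) : g \in unitmx ->
  affine_image g t (A `&` B) = affine_image g t A `&` affine_image g t B.
Proof.
move=> ug; apply/seteqP; split=> [_ [x [Ax Bx] <-]|_ [[x Ax <-] [y By]]].
  by split; exists x.
move=> /addIr/(congr1 (mulmx (invmx g))); rewrite !mulKmx// => xy.
by exists x => //; split => //; rewrite -xy.
Qed.

Lemma translation_affine_image (t : V) (A : set V) :
  [set x + t | x in A] = affine_image 1%:M t A.
Proof. by rewrite /affine_image; congr (_ @` A); apply/funext => x; rewrite mul1mx. Qed.

Lemma scale_affine_image (lam : R) (A : set V) :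
  [set lam *: x | x in A] = affine_image lam%:M 0 A.
Proof. by rewrite /affine_image; congr (_ @` A); apply/funext => x; rewrite mul_scalar_mx addr0. Qed.

Lemma linear_affine_image (k : 'M[R]_n) (A : set V) :
  [set k *m x | x in A] = affine_image k 0 A.
Proof. by rewrite /affine_image; congr (_ @` A); apply/funext => x; rewrite addr0. Qed.

Lemma extend0_affine phi (g : 'M[R]_n) (t : V) L :
  extend0 phi (affine_image g t L) = phi (affine_body g t L).
Proof. by rewrite (extend0E _ (affine_image_body g t L)). Qed.

Lemma affine_image_norm (g : 'M[R]_n) (t : V) L (rho : R) x :
  (forall x, (L : set V) x -> `|x| <= rho) -> affine_image g t L x ->
  `|x| <= n%:R * `|g| * rho + `|t|.
Proof.
move=> hL [y Ly <-]; apply: (le_trans (ler_normD _ _)); rewrite lerD2r.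
by apply: (le_trans (mulmx_norm_le _ _)); rewrite ler_wpM2l ?mulr_ge0// hL.
Qed.

Lemma homogeneous_linear_bound phi (j : nat) (rho : R) :
  hausdorff_continuous phi -> homogeneous_of_degree j phi -> 0 <= rho ->
  exists2 C : R, 0 <= C & forall L (g : 'M[R]_n) (s : R),
    (forall x, (L : set V) x -> `|x| <= rho) -> 0 < s -> `|g| <= s ->
    `|extend0 phi (affine_image g 0 L)| <= C * s ^+ j.
Proof.
move=> cphi hj rho0.
(* Matrices of norm at most 1 map the ball of radius [rho] into this one. Below, [g] is written as
   [s] times such a matrix, and homogeneity extracts [s ^+ j]; a free [s >= |g|] avoids dividing by
   the norm of a zero matrix. *)
have [C C0 hC] := hausdorff_continuous_bounded cphi (@compact_ball_cV R n (n%:R * rho)).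
exists C => // L g s hL s0 gs.
pose g' := s^-1 *: g.
have g'1 : `|g'| <= 1.
  by rewrite normrZ ger0_norm ?invr_ge0 ?(ltW s0)// ler_pdivrMl// mulr1.
have -> : affine_image g 0 L = [set s *: x | x in affine_body g' 0 L].
  rewrite scale_affine_image affine_image_comp mulmx0 addr0 mul_scalar_mx scalerA divff ?gt_eqF//.
  by rewrite scale1r.
rewrite hj ?(ltW s0)// normrM ger0_norm ?exprn_ge0 ?(ltW s0)// mulrC ler_wpM2r ?exprn_ge0 ?(ltW s0)//.
apply: hC => x /(affine_image_norm hL) /= h; apply: (le_trans h).
by rewrite normr0 addr0 ler_wpM2r// ler_piMr.
Qed.

End affine_images.

Section averaged_valuation.
Context {R : realType} {n : nat}.
Local Notation V := 'cV[R]_n.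
Implicit Types (L M : convex_body R n).
Context (ga : {finite_measure set (borel 'M[R]_n) -> \bar R}) (P : set (borel 'M[R]_n))
  (E : 'M[R]_n -> 'M[R]_n) (a : R).
Hypotheses (mP : measurable P) (mE : measurable_fun P (E : borel 'M[R]_n -> borel 'M[R]_n))
  (Eunit : forall X, P X -> E X \in unitmx) (a0 : 0 <= a)
  (Enorm : forall X, `|E X| <= expR (a * `|X|))
  (gaexp : forall b : R, 0 <= b -> (\int[ga]_X (expR (b * `|X : 'M[R]_n|))%:E < +oo)%E).
Context (psi : convex_body R n -> R) (j : nat).
Hypotheses (vpsi : valuation psi) (tpsi : translation_invariant psi)
  (cpsi : hausdorff_continuous psi) (hpsi : homogeneous_of_degree j psi).

(** Used with [E = expmx]; what enters below is the measurability of [E] and its invertibility on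
    [P], together with its exponential growth. [Rintegral] is real-valued by convention, and
    [integrable_averaged] shows that no default value is taken. *)
Definition averaged L : R := Rintegral ga P (fun X => extend0 psi (affine_image (E X) 0 L)).

Lemma integrable_exp_norm (C b : R) : 0 <= b ->
  ga.-integrable P (fun X => (C * expR (b * `|X : 'M[R]_n|))%:E).
Proof.
move=> b0; apply: (integrableS measurableT) => //.
under eq_fun do rewrite EFinM; apply: integrableZl => //.
apply/integrableP; split.
  apply/measurable_EFinP; apply: (measurableT_comp (@measurable_expR R)).
  by apply: measurable_funM => //; apply: continuous_borel_measurableR; exact: norm_continuous.
under eq_integral do rewrite /= ger0_norm ?expR_ge0//.
exact: gaexp.
Qed.

(** The bound is uniform over all bodies in a ball, so it gives both integrability and the
    dominating function for continuity. *)
Lemma averaged_bound (rho : R) : 0 <= rho -> exists2 C : R, 0 <= C & forall L X,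
  (forall x, (L : set V) x -> `|x| <= rho) ->
  `|extend0 psi (affine_image (E X) 0 L)| <= C * expR (j%:R * a * `|X|).
Proof.
move=> rho0; have [C C0 hC] := homogeneous_linear_bound cpsi hpsi rho0.
exists C => // L X hL; rewrite -mulrA expRM_natl.
by apply: hC => //; exact: expR_gt0.
Qed.

Lemma measurable_averaged L :
  measurable_fun P (fun X : borel 'M[R]_n => extend0 psi (affine_image (E X) 0 L)).
Proof.
exact: (measurableT_comp (measurable_linear_image L cpsi) mE).
Qed.

Lemma integrable_averaged L :
  ga.-integrable P (EFin \o (fun X : borel 'M[R]_n => extend0 psi (affine_image (E X) 0 L))).
Proof.
have [rho rho0 hrho] := body_bounded L.
have [C C0 hC] := averaged_bound (ltW rho0).
have ja0 : 0 <= j%:R * a by rewrite mulr_ge0.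
apply: (le_integrable mP _ _ (integrable_exp_norm C ja0)).
  by apply/measurable_EFinP; exact: measurable_averaged.
move=> X _ /=; rewrite lee_fin [leRHS]ger0_norm ?mulr_ge0 ?expR_ge0//.
exact: hC.
Qed.

Lemma averaged_valuation : valuation averaged.
Proof.
move=> M L bU.
have iM := integrable_averaged M; have iL := integrable_averaged L.
rewrite (extend0E _ bU).
have UE X : P X -> extend0 psi (affine_image (E X) 0 (M `|` L)) =
    extend0 psi (affine_image (E X) 0 M) + extend0 psi (affine_image (E X) 0 L)
    - extend0 psi (affine_image (E X) 0 (M `&` L)).
  (* The union of the images is the image of a convex body; invertibility of [E X] is what makes the
     image commute with the intersection. *)
  move=> PX; have bEU : is_convex_body (affine_body (E X) 0 M `|` affine_body (E X) 0 L).
    by rewrite /= -affine_imageU; exact: (affine_image_body _ _ (ConvexBody bU)).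
  rewrite affine_imageU (vpsi bEU) affine_imageI ?Eunit//.
  by rewrite !extend0_affine.
have [h|h] := pselect ((M `&` L : set V) !=set0).
  have bI := body_setI_body h; rewrite (extend0E _ bI).
  have iI := integrable_averaged (ConvexBody bI).
  have iD : ga.-integrable P (EFin \o (fun X => extend0 psi (affine_image (E X) 0 M) +
      extend0 psi (affine_image (E X) 0 L))).
    by rewrite /comp; under eq_fun do rewrite EFinD; exact: integrableD.
  rewrite -RintegralD// -RintegralB//.
  by apply: eq_Rintegral => X /set_mem PX; exact: UE.
have I0 : M `&` L = set0 :> set V by apply/seteqP; split => // x Mx; apply: h; exists x.
rewrite I0 (extend0_empty averaged)// subr0 -RintegralD//.
apply: eq_Rintegral => X /set_mem PX; rewrite UE// I0.
by rewrite [X in _ - X]extend0_empty ?subr0// /affine_image image_set0.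
Qed.

Lemma averaged_translation : translation_invariant averaged.
Proof.
move=> M t; rewrite translation_affine_image extend0_affine.
apply: eq_Rintegral => X _ /=; rewrite [RHS]extend0_affine -(tpsi _ (E X *m t)).
congr extend0.
by rewrite translation_affine_image !affine_image_comp mul1mx mulmx1 mulmx0 addr0 add0r.
Qed.

Lemma averaged_homogeneous : homogeneous_of_degree j averaged.
Proof.
move=> lam M lam0; rewrite scale_affine_image extend0_affine.
rewrite -RintegralZl//; last exact: integrable_averaged.
apply: eq_Rintegral => X _ /=; rewrite [X in _ = _ * X]extend0_affine -hpsi//.
congr extend0.
by rewrite scale_affine_image !affine_image_comp !mulmx0 scalar_mxC.
Qed.

(** A failure yields bodies within [1 / (m + 1)] of [M] whose averages stay away from that of [M].
    They all lie in one ball, so dominated convergence applies and contradicts this. *)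
Lemma averaged_continuous : hausdorff_continuous averaged.
Proof.
have cps := cpsi; move/hausdorff_continuousP : cps => cps.
apply/hausdorff_continuousP => M eps eps0.
have [//|H] := pselect (exists2 delta : R, 0 < delta &
    forall L, close_sets delta (M : set V) L -> `|averaged L - averaged M| < eps).
exfalso.
have bad m : exists L, close_sets (m.+1%:R^-1 : R) (M : set V) L /\ eps <= `|averaged L - averaged M|.
  have [//|h] := pselect (exists L, close_sets (m.+1%:R^-1 : R) (M : set V) L /\ eps <= `|averaged L - averaged M|).
  exfalso; apply: H; exists m.+1%:R^-1; first by rewrite invr_gt0.
  by move=> L ML; rewrite ltNge; apply/negP => hL; apply: h; exists L.
have [F hF] := choice bad.
have [rho rho0 hrho] := body_bounded M.
have hrho' m x : (F m : set V) x -> `|x| <= rho + 1.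
  move=> Fx; have [[_ /(_ x Fx)[y My yx]] _] := hF m.
  rewrite -(subrK y x); apply: (le_trans (ler_normD _ _)); rewrite addrC lerD ?hrho//.
  by rewrite distrC (le_trans yx)// invf_le1// ler1n.
have hrhoM x : (M : set V) x -> `|x| <= rho + 1 by move=> Mx; rewrite (le_trans (hrho x Mx))// lerDl.
have r1 : 0 <= rho + 1 by rewrite addr_ge0// ltW.
have [C C0 hC] := averaged_bound r1.
have ja0 : 0 <= j%:R * a by rewrite mulr_ge0.
pose f_ m X := (extend0 psi (affine_image (E X) 0 (F m)))%:E.
pose f X := (extend0 psi (affine_image (E X) 0 M))%:E.
have [_ _] : [/\ ga.-integrable P f,
    [sequence \int[ga]_(X in P) `|f_ m X - f X|]_m @ \oo --> 0 &
    [sequence \int[ga]_(X in P) f_ m X]_m @ \oo --> \int[ga]_(X in P) f X]%E.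
  apply: (dominated_convergence mP _ _ _ (integrable_exp_norm C ja0)).
  - by move=> m; apply/measurable_EFinP; exact: measurable_averaged.
  - by apply/measurable_EFinP; exact: measurable_averaged.
  - apply: aeW => X PX; apply: cvg_EFin; first by apply: nearW.
    apply/cvgrPdist_lt => e e0 /=.
    have [d d0 hd] := cps (affine_body (E X) 0 M) e e0.
    pose b := n%:R * `|E X| + 1.
    have b0 : 0 < b by rewrite ltr_wpDl// mulr_ge0.
    have [k hk] : exists k, (k.+1%:R^-1 : R) < d / b.
      have db : 0 < d / b by rewrite divr_gt0.
      by have [k] := @ltr_add_invr R 0 _ db; rewrite add0r => ?; exists k.
    exists k => // m /= km; rewrite !extend0_affine distrC; apply: hd => /=.
    have mk : (m.+1%:R^-1 : R) <= d / b.
      by apply: le_trans (ltW hk); rewrite lef_pV2 ?posrE// ler_nat.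
    have dist (x y : V) : `|x - y| <= m.+1%:R^-1 -> `|(E X *m x + 0) - (E X *m y + 0)| <= d.
      move=> xy; rewrite !addr0 -mulmxBr; apply: (le_trans (mulmx_norm_le _ _)).
      apply: (@le_trans _ _ (b * (d / b))); last by rewrite mulrCA divff ?mulr1// gt_eqF.
      apply: ler_pM; [by rewrite mulr_ge0| |by rewrite lerDl|exact: le_trans mk].
      exact: normr_ge0.
    have [[MF FM] _] := hF m.
    split=> [_ [x Mx <-]|_ [y Fy <-]].
      by have [y Fy xy] := MF x Mx; exists (E X *m y + 0); [exists y|exact: dist].
    by have [x Mx xy] := FM y Fy; exists (E X *m x + 0); [exists x|exact: dist].
  - by apply: aeW => X m PX; rewrite /f_ /= lee_fin hC// => x; exact: hrho'.
move=> cv.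
have : averaged (F m) @[m --> \oo] --> averaged M.
  apply: fine_cvg; rewrite /averaged /Rintegral fineK; first exact: cv.
  exact: (integrable_fin_num mP (integrable_averaged M)).
move=> /cvgrPdist_lt/(_ eps eps0)[k _ /(_ k (leqnn k))] /=.
by rewrite distrC ltNge (hF k).2.
Qed.

End averaged_valuation.

Lemma integral_invariant d (T : measurableType d) (R : realType) (mu : {measure set T -> \bar R})
    (F : T -> T) (D : set T) (f : T -> \bar R) :
  measurable_fun setT F -> measurable D -> measurable_fun D f ->
  (forall A, measurable A -> mu (F @^-1` A) = mu A) -> F @^-1` D = D ->
  (\int[mu]_(x in D) f (F x) = \int[mu]_(x in D) f x)%E.
Proof.
move=> mF mD mf muF FD.
have pos (g : T -> \bar R) : measurable_fun D g -> (forall x, 0 <= g x)%E ->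
    (\int[mu]_(x in D) (g \o F) x = \int[mu]_(x in D) g x)%E.
  move=> mg g0; rewrite -{1}FD -ge0_integral_pushforward//.
  by apply: eq_measure_integral => A mA _; exact: muF.
rewrite [LHS]integralE [RHS]integralE; congr (_ - _)%E.
  under eq_integral do rewrite (_ : (fun x => f (F x)) = f \o F)// funepos_comp.
  by apply: pos => //; exact: measurable_funepos.
under eq_integral do rewrite (_ : (fun x => f (F x)) = f \o F)// funeneg_comp.
by apply: pos => //; exact: measurable_funeneg.
Qed.

Lemma orthogonal_norm_le (R : realType) n (k : 'M[R]_n) : k^T *m k = 1%:M -> `|k| <= 1.
Proof.
move=> kk; apply: mx_norm_le => // i j.
have := congr1 (fun A : 'M[R]_n => A j j) kk; rewrite !mxE eqxx /= => h.
rewrite -(@expr_le1 _ 2)// real_normK ?num_real// -[leRHS]h.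
under eq_bigr do rewrite mxE -expr2.
by rewrite (bigD1 i)//= lerDl; apply: sumr_ge0 => l _; exact: sqr_ge0.
Qed.

Section homogeneous_basis.
Context {R : realType} {n N : nat} (K : set 'M[R]_n).
Context (psi : 'I_N -> convex_body R n -> R) (deg : 'I_N -> nat).
Hypotheses (hpsi : is_basis (ValK K) psi) (hdeg : forall i, ValKj K (deg i) (psi i)).

(* Dilation by [2] separates the degrees. *)
Lemma homogeneous_span (phi : convex_body R n -> R) (j : nat) : ValKj K j phi ->
  exists b : 'I_N -> R, forall M, phi M = \sum_(l < N | deg l == j) b l * psi l M.
Proof.
have [_ lin gen] := hpsi; move=> [Kphi hphi].
have [b bE] := gen _ Kphi; exists b => M.
(* The relation [phi (2 L) = 2^j phi L], expanded in the basis, is a vanishing linear combination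
   with these coefficients. *)
have b0 : forall l, b l * (2 ^+ deg l - 2 ^+ j) = 0.
  apply: lin => L; have two0 : 0 <= 2 :> R by [].
  have := hphi 2 L two0; rewrite scale_affine_image extend0_affine !bE mulr_sumr => /eqP.
  rewrite -subr_eq0 -sumrB => /eqP h; rewrite -[RHS]h; apply: eq_bigr => l _.
  have [_ /(_ 2 L two0)] := hdeg l; rewrite scale_affine_image extend0_affine => ->.
  by rewrite mulrBr mulrBl !mulrA; congr (_ - _ * _); rewrite mulrC.
rewrite bE [RHS]big_mkcond/=; apply: eq_bigr => l _.
case: eqVneq => // lj; have /eqP := b0 l; rewrite mulf_eq0 subr_eq0 => /orP[/eqP->|].
  by rewrite mul0r.
move=> /eqP h; exfalso; move/eqP: lj; apply; apply/eqP.
by rewrite eqn_leq -!(@ler_eXn2l _ (2 : R)) ?ltr1n// h lexx.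
Qed.

End homogeneous_basis.

Section cartan_average.
Context {R : realType} {n : nat} (G : set 'M[R]_n) (g0 : {vspace 'M[R]_n}).
Context (Theta : 'M[R]_n -> 'M[R]_n) (theta : 'End('M[R]_n)).
Hypotheses (hG : closed_linear_group G) (hg0 : is_lie_algebra G g0)
  (hcd : cartan_decomposition G g0 Theta theta).
Let K := fixed_subgroup G Theta.
Let p0 := noncompact_part g0 theta.
Hypotheses (hKc : compact K) (hKO : forall k, K k -> k^T *m k = 1%:M).
Context (e : (\dim p0).-tuple 'M[R]_n) (he : orthonormal_basis_of p0 e).
Context (ga : {finite_measure set (borel 'M[R]_n) -> \bar R}).
Hypothesis gaE : ga = gaussian_span e :> (set _ -> \bar R).
Hypothesis gaexp : forall b : R, 0 <= b -> (\int[ga]_X (expR (b * `|X : 'M[R]_n|))%:E < +oo)%E.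
Let P : set (borel 'M[R]_n) := [set X | X \in p0].

Lemma averaged_invariant (psi : convex_body R n -> R) :
  hausdorff_continuous psi -> invariant_under K psi ->
  invariant_under K (averaged ga P expmx psi).
Proof.
move=> cpsi Kpsi k M Kk.
have kk := hKO Kk; have kk' := mulmx1C kk; have KkT := fixed_subgroup_tr hG hcd hKO Kk.
have mP : measurable P := measurable_noncompact_part he.
pose F (X : 'M[R]_n) := k^T *m X *m k.
(* The average for [k M] involves [e^X k = k e^(F X)], where [F] is conjugation by the inverse
   [k^T]; hence the orthogonal matrix is taken for [k^T]. *)
have [Q QQ FQ] := noncompact_part_conj_orthogonal hG hg0 hcd hKO he KkT.
rewrite trmxK in FQ.
have mF : measurable_fun setT (F : borel 'M[R]_n -> borel 'M[R]_n).
  by apply: continuous_borel_measurable; exact: conjmx_continuous.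
have FP : F @^-1` P = P.
  apply/seteqP; split=> X.
    rewrite /P/= => /(noncompact_part_conj hG hg0 hcd hKO Kk).
    by rewrite /F !mulmxA kk' mul1mx -mulmxA kk' mulmx1.
  by rewrite /P/= => /(noncompact_part_conj hG hg0 hcd hKO KkT); rewrite trmxK.
rewrite linear_affine_image extend0_affine /averaged /Rintegral; congr fine.
pose f (X : borel 'M[R]_n) := (extend0 psi (affine_image (expmx X) 0 M))%:E.
have mf : measurable_fun P f.
  apply/measurable_EFinP.
  exact: (measurable_averaged (measurable_expmx_part hG hcd hKc he) cpsi M).
have gaF (A : set (borel 'M[R]_n)) : measurable A -> ga (F @^-1` A) = ga A.
  move=> mA; have := mF measurableT A mA; rewrite setTI => mFA.
  by rewrite gaE; apply: (gaussian_span_invariant he.2 QQ FQ).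
have fE X : (extend0 psi (affine_image (expmx X) 0 (affine_body k 0 M)))%:E = f (F X).
  rewrite /f /F -{1}(trmxK k) expmx_conj ?trmxK// [in RHS]extend0_affine.
  rewrite -(Kpsi _ (affine_body _ _ _) Kk) linear_affine_image /=.
  by rewrite !affine_image_comp !mulmx0 !addr0 !mulmxA kk' mul1mx.
under eq_integral do rewrite fE.
exact: (integral_invariant mF mP mf gaF FP).
Qed.

Lemma averaged_ValKj (psi : convex_body R n -> R) (j : nat) :
  ValKj K j psi -> ValKj K j (averaged ga P expmx psi).
Proof.
move=> [[[vpsi tpsi cpsi] Kpsi] hpsi].
have mP : measurable P := measurable_noncompact_part he.
have mE := measurable_expmx_part hG hcd hKc he.
have Eu X : P X -> expmx X \in unitmx by move=> /(expmx_group hg0)/(clg_unit hG).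
have a0 : 0 <= n.+1%:R :> R by [].
have nE := @expmx_norm_le R n.
split; last exact: (averaged_homogeneous mP mE a0 nE gaexp cpsi hpsi).
split; last exact: averaged_invariant.
split.
- exact: (averaged_valuation mP mE Eu a0 nE gaexp vpsi cpsi hpsi).
- exact: (averaged_translation _ _ _ tpsi).
- exact: (averaged_continuous mP mE a0 nE gaexp cpsi hpsi).
Qed.

End cartan_average.

(** * Disintegration of the kinematic integral *)

Section triple_product.
Context d1 d2 d3 (T1 : measurableType d1) (T2 : measurableType d2) (T3 : measurableType d3).
Context (R : realType) (m1 : probability T1 R) (m2 : {sigma_finite_measure set T2 -> \bar R}).
Context (m3 : {sigma_finite_measure set T3 -> \bar R}).
Context (f : T1 * T2 * T3 -> \bar R) (g : T2 -> \bar R).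
Hypotheses (mf : measurable_fun setT f) (ig : m2.-integrable setT g) (g0 : forall y, (0 <= g y)%E)
  (gfin : forall y, (g y < +oo)%E)
  (fg : forall x y, (\int[m3]_z `|f (x, y, z)| <= g y)%E).
(* The library has no canonical sigma-finite structure on a product measure. *)
Context (m12 : {sigma_finite_measure set (T1 * T2)%type -> \bar R}).
Hypothesis m12E : m12 = (m1 \x m2)%E :> (set _ -> \bar R).

(** The bound [g] does not depend on the first variable, over which the measure is a probability, so
    Tonelli bounds the whole integral by that of [g]. *)
Lemma integrable_product3 : (m12 \x m3)%E.-integrable setT f.
Proof.
apply: (integrable12ltyP m12 m3 mf).2.
apply: (@le_lt_trans _ _ (\int[m12]_xy g xy.2)%E).
  apply: ge0_le_integral => //.
  - by move=> xy _; exact: integral_ge0.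
  - apply: (@measurable_fun_fubini_tonelli_F _ _ _ _ R m3 (abse \o f)) => //.
    exact: measurableT_comp.
  - by move=> xy; exact: abse_ge0.
  - by apply: (measurableT_comp (measurable_int _ ig)).
  - by case=> x y _; exact: fg.
have mg : measurable_fun setT (fun xy : T1 * T2 => g xy.2).
  by apply: (measurableT_comp (measurable_int _ ig)).
rewrite m12E (@fubini_tonelli1 _ _ _ _ _ m1 m2 _ mg)//.
rewrite /fubini_F /= integral_cst//= probability_setT mule1.
have /integrableP[_] := ig.
by under eq_integral do rewrite gee0_abs//.
Qed.

Lemma integrable_product3_section y : (m1 \x m3)%E.-integrable setT (fun z => f (z.1, y, z.2)).
Proof.
have ms : measurable_fun setT (fun z : T1 * T3 => f (z.1, y, z.2)).
  apply: (measurableT_comp mf).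
  by apply: measurable_fun_pair => //; exact: measurable_fun_pair.
apply: (integrable12ltyP m1 m3 ms).2.
apply: (@le_lt_trans _ _ (\int[m1]_x g y)%E).
  apply: ge0_le_integral => //.
  - by move=> x _; exact: integral_ge0.
  - apply: (@measurable_fun_fubini_tonelli_F _ _ _ _ R m3
      (abse \o (fun z : T1 * T3 => f (z.1, y, z.2)))) => //.
    exact: measurableT_comp.
  - by move=> z; exact: abse_ge0.
  - by move=> x _; exact: fg.
by rewrite integral_cst//= probability_setT mule1.
Qed.

Lemma integral_product3 :
  (\int[m12 \x m3]_w f w = \int[m2]_y \int[m1 \x m3]_z f (z.1, y, z.2))%E.
Proof.
have i3 := integrable_product3.
(* The third variable is integrated first, then the first two are exchanged, and finally the first
   and third are recombined. The recombination holds for every [y], since [g y] is finite. *)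
have := integrable_fubini_F i3; rewrite -(integral12_prod_meas1 i3) m12E => iF.
rewrite -(integral21_prod_meas1 iF).
apply: eq_integral => y _.
exact: (integral12_prod_meas1 (integrable_product3_section y)).
Qed.

End triple_product.

Section disintegration.
Context {R : realType} {n : nat}.
Local Notation V := 'cV[R]_n.
Implicit Types (L M : convex_body R n).
Context (nu : probability (borel 'M[R]_n) R) (K : set (borel 'M[R]_n)).
Context (ga : {finite_measure set (borel 'M[R]_n) -> \bar R}) (P : set (borel 'M[R]_n))
  (E : 'M[R]_n -> 'M[R]_n) (a : R).
Hypotheses (mK : measurable K) (K1 : forall k : 'M[R]_n, K k -> `|k| <= 1).
Hypotheses (mP : measurable P) (a0 : 0 <= a)
  (mE : measurable_fun (K `*` P)
     (fun kX : borel 'M[R]_n * borel 'M[R]_n => kX.1 *m E kX.2 : borel 'M[R]_n))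
  (Enorm : forall X, `|E X| <= expR (a * `|X|))
  (gaexp : forall b : R, 0 <= b -> (\int[ga]_X (expR (b * `|X : 'M[R]_n|))%:E < +oo)%E).
Context (phi : convex_body R n -> R).
Hypothesis cphi : hausdorff_continuous phi.

Lemma lebesgue_cV_closed_ball (r : R) (mu : {measure set (borel V) -> \bar R}) :
  mu = @lebesgue_cV R n :> (set _ -> \bar R) -> 0 <= r ->
  (mu [set t : borel V | (`|t : V| <= r)%R] <= (((r + 1) *+ 2) ^+ n)%:E)%E.
Proof.
move=> muE r0; have [la laE hla] := lebesgue_cV_measure R n.
rewrite -hla ?ltr_wpDl// laE muE.
rewrite -muE; apply: le_measure; rewrite ?inE.
- by apply: measurable_closed_borel; apply: compact_closed (@compact_ball_cV R n r); exact: norm_hausdorff.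
- by apply: measurable_open_borel; apply: (@ball_open R V); rewrite ltr_wpDl.
- by move=> t /= tr; rewrite -ball_normE /ball_/= sub0r normrN (le_lt_trans tr)// ltrDl.
Qed.

(** The bodies meet only if [t = x - g y] with [x] in [M] and [y] in [L], which bounds [|t|]; the
    value is bounded since the intersection lies in [M]. *)
Lemma intersection_bound M L : exists2 C : R, 0 <= C & exists2 rho : R, 0 < rho &
  forall (g : 'M[R]_n) (t : V),
    `|extend0 phi (M `&` affine_image g t L)| <=
    C * (\1_[set t : V | `|t| <= rho * (1 + `|g|)] t).
Proof.
have [_ cM _] := body_convex M.
have [C C0 hC] := hausdorff_continuous_bounded cphi cM.
have [rM rM0 hM] := body_bounded M; have [rL rL0 hL] := body_bounded L.
exists C => //; exists (rM + n%:R * rL); first by rewrite ltr_pwDl// mulr_ge0// ltW.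
move=> g t; have [h|h] := pselect ((M `&` affine_image g t L : set V) !=set0); last first.
  rewrite extend0_empty ?normr0 ?mulr_ge0//.
  by apply/seteqP; split=> // x Mx; apply: h; exists x.
have bI : is_convex_body (M `&` affine_body g t L) by exact: body_setI_body.
rewrite (extend0E _ bI) indicE mem_set ?mulr1.
  by apply: hC => x [].
have [x [Mx [y Ly yx]]] := h => /=.
have -> : t = x - g *m y by rewrite -yx addrC addKr.
apply: (le_trans (ler_normB _ _)); rewrite mulrDr mulr1.
rewrite mulrDl [rM * `|g|]mulrC addrA -[leLHS]addr0 -addrA.
have h1 := hM x Mx; have h2 := mulmx_norm_le g y; have h3 := hL y Ly.
have h4 : n%:R * `|g| * `|y| <= n%:R * rL * `|g|.
  by rewrite mulrAC ler_wpM2r// ler_wpM2l.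
have h5 : 0 <= n%:R * rL by rewrite mulr_ge0// ltW.
have h6 : 0 <= `|g| * rM by rewrite mulr_ge0// ltW.
lra.
Qed.

Let f M L (z : borel 'M[R]_n * borel 'M[R]_n * borel V) : \bar R :=
  ((fun z => (extend0 phi (M `&` affine_image (z.1.1 *m E z.1.2) z.2 L))%:E) \_ ((K `*` P) `*` setT)) z.

Lemma measurable_moved_intersection M L : measurable_fun setT (f M L).
Proof.
apply/(measurable_restrictT _ _).1 => //; first by apply: measurableX => //; exact: measurableX.
apply/measurable_EFinP.
(* The product map is known to be measurable only on [K] times [P], so it is extended by 0 before
   being composed with the intersection function, which is measurable everywhere. *)
pose m (kX : borel 'M[R]_n * borel 'M[R]_n) : borel 'M[R]_n := kX.1 *m E kX.2.
have mm : measurable_fun setT (m \_ (K `*` P)).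
  by apply/(measurable_restrictT _ _).1 => //; exact: measurableX.
have mp : measurable_fun setT (fun z : borel 'M[R]_n * borel 'M[R]_n * borel V =>
    ((m \_ (K `*` P)) z.1, z.2)).
  by apply: measurable_fun_pair => //; exact: (measurableT_comp mm).
have mD : measurable (((K `*` P) `*` setT) : set (borel 'M[R]_n * borel 'M[R]_n * borel V)%type).
  by apply: measurableX => //; exact: measurableX.
have := measurable_funTS (measurableT_comp (measurable_intersection M L cphi) mp) (D := (K `*` P) `*` setT).
by apply: eq_measurable_fun => z /set_mem[zD _] /=; rewrite patchT// inE.
Qed.

Lemma moved_intersection_bound M L : exists2 C : R, 0 <= C & exists2 b : R, 0 <= b &
  forall (mu : {measure set (borel V) -> \bar R}),
  mu = @lebesgue_cV R n :> (set _ -> \bar R) -> forall kX,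
  (\int[mu]_t `|f M L (kX, t)| <= (C * expR (b * `|kX.2 : 'M[R]_n|))%:E)%E.
Proof.
have [C C0 [rho rho0 hC]] := intersection_bound M L.
(* The translations that matter have norm at most [r = rho (1 + n e^(a|X|))], a ball inside the open
   cube of side [2 (r + 1)]. As [e^(a|X|) >= 1], this side is at most [D e^(a|X|)]. *)
pose D := (rho * (1 + n%:R) + 1) *+ 2.
have D0 : 0 <= D by rewrite mulrn_wge0// addr_ge0// mulr_ge0 ?addr_ge0// ltW.
exists (C * D ^+ n); first by rewrite mulr_ge0// exprn_ge0.
exists (n%:R * a); first by rewrite mulr_ge0.
move=> mu muE [k X] /=.
have e1 : 1 <= expR (a * `|X : 'M[R]_n|) by rewrite -expR0 ler_expR mulr_ge0.
pose r := rho * (1 + n%:R * expR (a * `|X : 'M[R]_n|)).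
have r0 : 0 <= r by rewrite mulr_ge0 ?addr_ge0 ?mulr_ge0 ?expR_ge0// ltW.
have mB : measurable ([set t | `|t : V| <= r] : set (borel V)).
  by apply: measurable_closed_borel; apply: compact_closed (@compact_ball_cV R n r); exact: norm_hausdorff.
apply: (@le_trans _ _ (\int[mu]_t (C * \1_([set t | `|t : V| <= r] : set (borel V)) t)%:E)%E).
  apply: ge0_le_integral => //.
  - apply: measurableT_comp => //; apply: (measurableT_comp (measurable_moved_intersection M L)).
    exact: pair1_measurable.
  - by apply/measurable_EFinP; apply: measurable_funM => //; exact: measurable_indic.
  move=> t _; rewrite /f /patch; case: ifPn => [/set_mem[[/= Kk PX] _]|_]; last first.
    by rewrite abse0 lee_fin mulr_ge0.
  rewrite lee_fin; apply: (le_trans (hC _ _)); rewrite ler_wpM2l// !indicE ler_nat.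
  case: (boolP (t \in _)) => // /set_mem /= tr; rewrite mem_set//=.
  apply: (le_trans tr); rewrite /r ler_wpM2l ?(ltW rho0)// lerD2l.
  apply: (le_trans (mulmx_norm_le _ _)); rewrite -mulrA ler_wpM2l//.
  by rewrite -[leRHS]mul1r ler_pM ?K1.
under eq_integral do rewrite EFinM.
rewrite ge0_integralZl//; last by apply/measurable_EFinP; exact: measurable_indic.
rewrite integral_indic// setIT -mulrA EFinM lee_wpmul2l ?lee_fin//.
apply: (le_trans (lebesgue_cV_closed_ball muE r0)).
rewrite lee_fin -mulrA expRM_natl -exprMn lerXn2r ?nnegrE ?mulr_ge0 ?expR_ge0 ?mulrn_wge0 ?addr_ge0 ?mulr_ge0 ?addr_ge0 ?(ltW rho0)//.
rewrite /D mulrnAl lerMn2r /= /r.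
have h1 : rho <= rho * expR (a * `|X : 'M[R]_n|) by rewrite ler_peMr// ltW.
lra.
Qed.

Context (la : {sigma_finite_measure set (borel V) -> \bar R}).
Hypothesis laE : la = @lebesgue_cV R n :> (set _ -> \bar R).
Context (m12 : {sigma_finite_measure set (borel 'M[R]_n * borel 'M[R]_n)%type -> \bar R}).
Hypothesis m12E : m12 = (nu \x ga)%E :> (set _ -> \bar R).

(** For fixed [X], the set [k e^X L + t] is the image of the body [e^X L] under [(k, t)], so the
    inner integral is a kinematic integral over [K] for that body. *)
Lemma kinematic_disintegration M L :
  (\int[m12 \x la]_(z in (K `*` P) `*` setT)
     (extend0 phi (M `&` affine_image (z.1.1 *m E z.1.2) z.2 L))%:E =
   \int[ga]_(X in P) \int[nu \x la]_(z in K `*` setT)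
     (extend0 phi (M `&` affine_image z.1 z.2 (affine_body (E X) 0 L)))%:E)%E.
Proof.
have [C C0 [b b0 hC]] := moved_intersection_bound M L.
have mf := measurable_moved_intersection M L.
have ig := integrable_exp_norm measurableT gaexp C b0.
rewrite integral_mkcond -[LHS]/(\int[m12 \x la]_z f M L z)%E.
rewrite (integral_product3 (g := fun X : borel 'M[R]_n => (C * expR (b * `|X : 'M[R]_n|))%:E) mf ig _ _ _ m12E); last 3 first.
- by move=> X; rewrite lee_fin mulr_ge0// expR_ge0.
- by move=> X; rewrite ltry.
- by move=> k X; exact: (hC la laE (k, X)).
rewrite [RHS]integral_mkcond; apply: eq_integral => X _.
rewrite [RHS]patchE; case: ifPn => XP.
  rewrite [RHS]integral_mkcond; apply: eq_integral => -[k t] _.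
  rewrite /f !patchE /= affine_image_comp mulmx0 add0r.
  congr (if _ then _ else _); apply/idP/idP => /set_mem.
    by move=> [[Kk _] _]; apply/mem_set.
  by move=> [Kk _]; apply/mem_set; split => //; split => //; exact: set_mem XP.
rewrite -[RHS](integral0 (nu \x la)%E setT); apply: eq_integral => -[k t] _.
rewrite /f patchE /= memNset//; move=> [[_ PX] _]; move/negP: XP; apply.
exact/mem_set.
Qed.

End disintegration.

Lemma product_finite_measure d1 d2 (T1 : measurableType d1) (T2 : measurableType d2) (R : realType)
    (m1 : {finite_measure set T1 -> \bar R}) (m2 : {finite_measure set T2 -> \bar R}) :
  exists m12 : {sigma_finite_measure set (T1 * T2)%type -> \bar R},
    m12 = (m1 \x m2)%E :> (set _ -> \bar R).
Proof.
have mT := product_measure1E m1 m2 measurableT measurableT; rewrite setXTT in mT.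
apply: (@sigma_finite_measureP _ _ _ (m1 \x m2)%E).
exists (fun=> setT) => [|_]; first by rewrite bigcup_const.
split; first exact: measurableT.
apply: (@le_lt_trans _ _ (m1 setT * m2 setT)%E); first by rewrite -mT.
by rewrite lte_mul_pinfty ?measure_ge0 ?fin_num_measure// ltey_eq fin_num_measure.
Qed.

Theorem theorem1p6 (R : realType) (n : nat)
    (G : set 'M[R]_n) (g0 : {vspace 'M[R]_n})
    (Theta : 'M[R]_n -> 'M[R]_n) (theta : 'End('M[R]_n))
    (hG : closed_linear_group G)
    (hGnc : ~ compact G)
    (hg0 : is_lie_algebra G g0)
    (hcd : cartan_decomposition G g0 Theta theta)
    (K := fixed_subgroup G Theta)
    (p0 := noncompact_part g0 theta)
    (hKc : compact K)
    (hKO : forall k, K k -> k^T *m k = 1%:M)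
    (nu : probability (borel 'M[R]_n) R)
    (hnu : haar_probability K nu)
    (e : (\dim p0).-tuple 'M[R]_n)
    (he : orthonormal_basis_of p0 e)
    (N : nat) (psi : 'I_N -> convex_body R n -> R) (deg : 'I_N -> nat)
    (hpsi : is_basis (ValK K) psi)
    (hdeg : forall i, ValKj K (deg i) (psi i))
    (phi : convex_body R n -> R)
    (hphi : ValK K phi)
    (c : 'I_N -> 'I_N -> R)
    (hc : forall M L : convex_body R n,
      kinematic_K K nu phi M L =
      (\sum_(i < N) \sum_(j < N) c i j * psi i M * psi j L)%:E) :
  exists cc : 'I_N -> 'I_N -> R,
    forall M L : convex_body R n,
      kinematic_G K nu p0 e phi M L =
      (\sum_(i < N) \sum_(j < N) \sum_(l < N | deg l == deg j)
         c i j * cc j l * psi i M * psi l L)%:E.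
Proof.
have mK := measurable_fixed_subgroup hKc.
have mP := measurable_noncompact_part he.
have mE := measurable_expmx_part hG hcd hKc he.
have mC := measurable_cartan hcd hKc he.
have [ga gaE gaexp] := gaussian_span_exp he.2.
have [la laE _] := lebesgue_cV_measure R n.
have [m12 m12E] := product_finite_measure nu ga.
have a0 : 0 <= n.+1%:R :> R by [].
have nE := @expmx_norm_le R n.
pose P : set (borel 'M[R]_n) := [set X | X \in p0].
have hspan j := homogeneous_span hpsi hdeg
  (averaged_ValKj hG hg0 hcd hKc hKO he gaE gaexp (hdeg j)).
(* These coordinates are chosen from the [psi j] and the Gaussian measure alone, before [M] and [L]
   are introduced; [phi] and [c] do not enter. *)
have [cc ccE] := choice hspan.
exists cc => M L.
have cphi : hausdorff_continuous phi by case: hphi => -[].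
rewrite /kinematic_G -gaE -m12E -laE.
have K1 k : K k -> `|k| <= 1 by move=> /hKO; exact: orthogonal_norm_le.
rewrite (kinematic_disintegration mK K1 mP a0 mC nE gaexp cphi laE m12E).
pose h j (X : borel 'M[R]_n) := (extend0 (psi j) (affine_image (expmx X) 0 L))%:E.
have ih j : ga.-integrable P (h j).
  have [[[_ _ cj] _] hj] := hdeg j.
  exact: (integrable_averaged mP mE a0 nE gaexp cj hj L).
(* The formula over [K] is applied to [M] and [e^X L]. It yields a finite sum of integrable
   functions of [X], which can be integrated term by term. *)
have hE X : (\int[nu \x la]_(z in (K : set (borel 'M[R]_n)) `*` setT)
     (extend0 phi (M `&` affine_image z.1 z.2 (affine_body (expmx X) 0 L)))%:E =
    \sum_(i < N) \sum_(j < N) (c i j * psi i M)%:E * h j X)%E.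
  rewrite laE; have := hc M (affine_body (expmx X) 0 L); rewrite /kinematic_K => ->.
  rewrite -sumEFin; apply: eq_bigr => i _; rewrite -sumEFin; apply: eq_bigr => j _.
  by rewrite /h extend0_affine EFinM.
under eq_integral do rewrite hE.
rewrite integral_sum//; last first.
  by move=> i; apply: integrable_sum => // j _; exact: integrableZl.
rewrite -sumEFin; apply: eq_bigr => i _.
rewrite integral_sum//; last by move=> j; exact: integrableZl.
rewrite -sumEFin; apply: eq_bigr => j _.
rewrite integralZl//.
have -> : (\int[ga]_(X in P) h j X)%E = (averaged ga P expmx (psi j) L)%:E.
  by rewrite /averaged /Rintegral fineK//; exact: (integrable_fin_num mP (ih j)).
rewrite ccE -EFinM mulr_sumr; congr EFin; apply: eq_bigr => l _.
by rewrite !mulrA; congr (_ * _); rewrite mulrAC.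
Qed.
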